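(* Let $R$ be a Noetherian ring and let $\Delta = (\mathfrak{p}_0, \ldots, \mathfrak{p}_n)$ be a flag of prime ideals of $R$. Let $\tilde{\Delta} = (\mathfrak{p}_0/\mathfrak{p}_0, \mathfrak{p}_1/\mathfrak{p}_0,\ldots,\mathfrak{p}_n/\mathfrak{p}_0)$ be the induced flag of prime ideals of $R/\mathfrak{p}_0$. Then $$\dim C_\Delta R = \mathrm{ht}\, \mathfrak{p}_0 + \dim C_{\tilde{\Delta}}(R/\mathfrak{p}_0),$$ where $\dim$ denotes Krull dimension.
   Context: All rings are commutative with identity. A flag of prime ideals $\Delta = (\mathfrak{p}_0,\ldots,\mathfrak{p}_n)$ of a ring $R$ ($n \ge 0$) is a non-empty finite set of prime ideals with $\mathfrak{p}_i \subsetneq \mathfrak{p}_{i+1}$ for $0 \le i < n$. For a prime $\mathfrak{p}$ of $R$ and an $R$-module (or $R$-algebra) $M$, $S^{-1}_{\mathfrak{p}}M$ denotes the localization of $M$ at $\mathfrak{p}$ (inverting the elements of $R\setminus\mathfrak{p}$), and $C_{\mathfrak{p}}M = \varprojlim_l M/\mathfrak{p}^l M$ denotes the $\mathfrak{p}$-adic completion of $M$. For a Noetherian ring $R$ the ind-pro completion of $R$ along $\Delta$ is the ring $$C_\Delta R = C_{\mathfrak{p}_0}S^{-1}_{\mathfrak{p}_0}\cdots C_{\mathfrak{p}_n}S^{-1}_{\mathfrak{p}_n}R$$ (first localize at and complete along $\mathfrak{p}_n$, ..., last along $\mathfrak{p}_0$). $C_{\tilde\Delta}(R/\mathfrak{p}_0)$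 is formed in the same way from the ring $R/\mathfrak{p}_0$ and its flag $\tilde\Delta$. *)

(* Defs.v *)
From HB Require Import structures.
From mathcomp Require Import all_boot all_order all_algebra.
From mathcomp Require Import generic_quotient ring_quotient.
From mathcomp Require Import mathcomp_extra boolp classical_sets.
From mathcomp Require Import constructive_ereal.
From mathcomp Require Import ring.

Set Implicit Arguments.
Unset Strict Implicit.
Unset Printing Implicit Defensive.

Import Order.TTheory GRing.Theory Num.Theory.
Local Open Scope classical_set_scope.
Local Open Scope ring_scope.
Local Open Scope quotient_scope.

(* Rings are possibly trivial (comPzRingType): a localization or a completion
   is not known a priori to be nonzero.  The ideals of ring_quotient are proper
   and live in nontrivial rings, hence the following more general versions. *)

HB.mixin Record isIdeal (R : comPzRingType) (S : R -> bool) := {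
  ideal_subproof : forall a, {in (S : {pred R}), forall u, a * u \in (S : {pred R})}
}.

#[short(type="ideal")]
HB.structure Definition Ideal (R : comPzRingType) :=
  {S of GRing.ZmodClosed R S & isIdeal R S}.

HB.mixin Record isPrime (R : comPzRingType) (S : R -> bool) := {
  prime_subproof1 : 1 \notin (S : {pred R});
  prime_subproofM : forall u v,
    u * v \in (S : {pred R}) -> (u \in (S : {pred R})) || (v \in (S : {pred R}))
}.

#[short(type="prime_ideal")]
HB.structure Definition PrimeIdeal (R : comPzRingType) :=
  {S of Ideal R S & isPrime R S}.

Section IdealTheory.
Variable R : comPzRingType.

Lemma ideal_mull (I : ideal R) a u : u \in I -> a * u \in I.
Proof. exact: ideal_subproof. Qed.

Lemma ideal_mulr (I : ideal R) a u : u \in I -> u * a \in I.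
Proof. by rewrite mulrC; apply: ideal_mull. Qed.

Lemma prime_ideal1 (p : prime_ideal R) : 1 \notin p.
Proof. exact: prime_subproof1. Qed.

Lemma prime_idealM (p : prime_ideal R) u v :
  u \notin p -> v \notin p -> u * v \notin p.
Proof. by move=> up vp; apply/negP => /prime_subproofM; rewrite (negPf up) (negPf vp). Qed.

Definition ideal_gen (S : set R) : {pred R} :=
  fun x => `[< forall I : ideal R, (forall y, S y -> y \in I) -> x \in I >].

Variable S : set R.

Lemma ideal_gen_zmod_closed : zmod_closed (ideal_gen S).
Proof.
split=> [|x y /asboolP xS /asboolP yS]; apply/asboolP => I SI.
  by rewrite rpred0.
by rewrite rpredB ?xS ?yS.
Qed.
HB.instance Definition _ :=
  GRing.isZmodClosed.Build R (ideal_gen S) ideal_gen_zmod_closed.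

Lemma ideal_gen_mul a :
  {in ideal_gen S, forall u, a * u \in ideal_gen S}.
Proof. by move=> u /asboolP uS; apply/asboolP => I SI; apply/ideal_mull/uS. Qed.
HB.instance Definition _ := isIdeal.Build R (ideal_gen S) ideal_gen_mul.

End IdealTheory.

Definition noetherian (R : comPzRingType) : Prop :=
  forall I : ideal R, exists s : seq R, I =i ideal_gen [set x | x \in s].

Definition ideal_pow (R : comPzRingType) (I : ideal R) (l : nat) : ideal R :=
  ideal_gen [set x | exists2 t : 'I_l -> R,
    (forall i, t i \in I) & x = \prod_(i < l) t i].

Definition ring_quot (R : comPzRingType) (I : ideal R) : Type := Quotient.quot I.

Section RingQuot.
Variables (R : comPzRingType) (I : ideal R).

HB.instance Definition _ := GRing.Zmodule.on (ring_quot I).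
HB.instance Definition _ := EqQuotient.on (ring_quot I).

Definition quot_pi : R -> ring_quot I := \pi_(ring_quot I).

Lemma quot_piE x y : (quot_pi x == quot_pi y) = (x - y \in I).
Proof. by rewrite /quot_pi -(Quotient.idealrBE I). Qed.

Lemma quot_reprK : cancel repr quot_pi.
Proof. exact: reprK. Qed.

Definition quot_one : ring_quot I := quot_pi 1.
Definition quot_mul (x y : ring_quot I) : ring_quot I :=
  quot_pi (repr x * repr y).

Lemma quot_repr x : repr (quot_pi x) - x \in I.
Proof. by rewrite -quot_piE quot_reprK. Qed.

Lemma quot_mulE x y : quot_mul (quot_pi x) (quot_pi y) = quot_pi (x * y).
Proof.
apply/eqP; rewrite quot_piE.
set x' := repr _; set y' := repr _.
have -> : x' * y' - x * y = x' * (y' - y) + y * (x' - x) by ring.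
by rewrite rpredD ?ideal_mull ?quot_repr.
Qed.

Lemma quot_piD x y : quot_pi (x + y) = quot_pi x + quot_pi y.
Proof. by rewrite /quot_pi (Quotient.pi_add I). Qed.

Lemma quot_mulA : associative quot_mul.
Proof.
move=> x y z; rewrite -[x]quot_reprK -[y]quot_reprK -[z]quot_reprK.
by rewrite !quot_mulE mulrA.
Qed.

Lemma quot_mulC : commutative quot_mul.
Proof.
by move=> x y; rewrite -[x]quot_reprK -[y]quot_reprK !quot_mulE mulrC.
Qed.

Lemma quot_mul1 : left_id quot_one quot_mul.
Proof. by move=> x; rewrite -[x]quot_reprK quot_mulE mul1r. Qed.

Lemma quot_mulDl : left_distributive quot_mul +%R.
Proof.
move=> x y z; rewrite -[x]quot_reprK -[y]quot_reprK -[z]quot_reprK.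
by rewrite -quot_piD !quot_mulE -quot_piD mulrDl.
Qed.

HB.instance Definition _ := GRing.Zmodule_isComPzRing.Build (ring_quot I)
  quot_mulA quot_mulC quot_mul1 quot_mulDl.

Lemma quot_pi_zmod_morphism : zmod_morphism quot_pi.
Proof.
by move=> x y; apply/eqP; rewrite -[eqbRHS]quot_reprK; apply/eqP; rewrite quot_reprK;
   apply: (addIr (quot_pi y)); rewrite -quot_piD !subrK.
Qed.
HB.instance Definition _ :=
  GRing.isZmodMorphism.Build R (ring_quot I) quot_pi quot_pi_zmod_morphism.

Lemma quot_pi_monoid_morphism : monoid_morphism quot_pi.
Proof. by split=> // x y; rewrite -quot_mulE. Qed.
HB.instance Definition _ :=
  GRing.isMonoidMorphism.Build R (ring_quot I) quot_pi quot_pi_monoid_morphism.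

End RingQuot.

(* The canonical map R / J -> R / I; it is meaningful when J is contained in I. *)
Definition quot_trans (R : comPzRingType) (J I : ideal R) (x : ring_quot J) :
  ring_quot I := quot_pi I (repr x).

Lemma quot_transE (R : comPzRingType) (J I : ideal R) : {subset J <= I} ->
  forall x, quot_trans I (quot_pi J x) = quot_pi I x.
Proof. by move=> JI x; apply/eqP; rewrite quot_piE JI ?quot_repr. Qed.

(* MathComp's comAlgType excludes the zero algebra. *)
Record algebra (R : comPzRingType) := Algebra {
  alg_ring :> comPzRingType;
  alg_map : {rmorphism R -> alg_ring}
}.

Definition base_algebra (R : comPzRingType) : algebra R := @Algebra R R idfun.

Section Localization.
Variables (R : comPzRingType) (p : prime_ideal R) (A : algebra R).
Local Notation f := (@alg_map R A).

Definition frac : Type := (A * {s : R | s \notin p})%type.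
HB.instance Definition _ := Choice.on frac.

Definition frac_den1 : {s : R | s \notin p} := Sub 1 (prime_ideal1 p).
Definition frac_denM (s t : {s : R | s \notin p}) : {s : R | s \notin p} :=
  Sub (\val s * \val t) (prime_idealM (valP s) (valP t)).

Definition frac_equiv (x y : frac) : bool :=
  `[< exists2 u : R, u \notin p &
      f u * (f (\val y.2) * x.1 - f (\val x.2) * y.1) = 0 >].

Lemma frac_equiv_refl : reflexive frac_equiv.
Proof.
by move=> x; apply/asboolP; exists 1; rewrite ?prime_ideal1 // subrr mulr0.
Qed.

Lemma frac_equiv_sym : symmetric frac_equiv.
Proof.
suff H x y : frac_equiv x y -> frac_equiv y x by move=> x y; apply/idP/idP; apply: H.
by move=> /asboolP[u up e]; apply/asboolP; exists u; rewrite // -opprB mulrN e oppr0.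
Qed.

Lemma frac_equiv_trans : transitive frac_equiv.
Proof.
move=> [b t] [a s] [c r] /asboolP/=[u up e] /asboolP/=[v vp e'].
apply/asboolP; exists (u * v * \val t) => /=.
  by rewrite !prime_idealM // (valP t).
rewrite !rmorphM.
transitivity (f v * f (\val r) * (f u * (f (\val t) * a - f (\val s) * b))
  + f u * f (\val s) * (f v * (f (\val r) * b - f (\val t) * c))); first by ring.
by rewrite e e' !mulr0 addr0.
Qed.

Canonical frac_equivRel :=
  EquivRel frac_equiv frac_equiv_refl frac_equiv_sym frac_equiv_trans.

Definition localization : Type := {eq_quot frac_equiv}.
HB.instance Definition _ := Choice.on localization.
HB.instance Definition _ := EqQuotient.on localization.

Definition loc_frac (a : A) (s : {s : R | s \notin p}) : localization :=
  \pi_localization ((a, s) : frac).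

Definition loc_num (x : localization) : A := (repr x).1.
Definition loc_den (x : localization) : {s : R | s \notin p} := (repr x).2.

Lemma loc_fracK x : loc_frac (loc_num x) (loc_den x) = x.
Proof. by rewrite /loc_frac -surjective_pairing reprK. Qed.

Lemma loc_fracP a s b t : loc_frac a s = loc_frac b t <->
  exists2 u : R, u \notin p & f u * (f (\val t) * a - f (\val s) * b) = 0.
Proof.
rewrite /loc_frac; split=> [/eqmodP/asboolP//|H].
by apply/eqmodP/asboolP.
Qed.

Lemma loc_ind (P : localization -> Prop) :
  (forall a s, P (loc_frac a s)) -> forall x, P x.
Proof. by move=> H x; rewrite -[x]loc_fracK. Qed.

Lemma loc_reprP a s : exists2 u : R, u \notin p &
  f u * (f (\val s) * loc_num (loc_frac a s)
         - f (\val (loc_den (loc_frac a s))) * a) = 0.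
Proof. by apply/loc_fracP; rewrite loc_fracK. Qed.

Definition loc_zero : localization := loc_frac 0 frac_den1.
Definition loc_one : localization := loc_frac 1 frac_den1.
Definition loc_opp (x : localization) : localization :=
  loc_frac (- loc_num x) (loc_den x).
Definition loc_add (x y : localization) : localization :=
  loc_frac (f (\val (loc_den y)) * loc_num x + f (\val (loc_den x)) * loc_num y)
           (frac_denM (loc_den x) (loc_den y)).
Definition loc_mul (x y : localization) : localization :=
  loc_frac (loc_num x * loc_num y) (frac_denM (loc_den x) (loc_den y)).

Lemma loc_oppE a s : loc_opp (loc_frac a s) = loc_frac (- a) s.
Proof.
have [u up e] := loc_reprP a s; apply/loc_fracP; exists u => //.
by rewrite -[RHS]oppr0 -[in RHS]e; ring.
Qed.

Lemma loc_addE a s b t : loc_add (loc_frac a s) (loc_frac b t) =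
  loc_frac (f (\val t) * a + f (\val s) * b) (frac_denM s t).
Proof.
rewrite /loc_add; have [v vp] := loc_reprP b t; have [u up] := loc_reprP a s.
move: (loc_num (loc_frac a s)) (loc_den (loc_frac a s)) => a' s' e.
move: (loc_num (loc_frac b t)) (loc_den (loc_frac b t)) => b' t' e'.
apply/loc_fracP; exists (u * v); rewrite ?prime_idealM //= !rmorphM.
transitivity (f v * f (\val t) * f (\val t') * (f u * (f (\val s) * a' - f (\val s') * a))
 + f u * f (\val s) * f (\val s') * (f v * (f (\val t) * b' - f (\val t') * b))).
  by ring.
by rewrite e e' !mulr0 addr0.
Qed.

Lemma loc_mulE a s b t :
  loc_mul (loc_frac a s) (loc_frac b t) = loc_frac (a * b) (frac_denM s t).
Proof.
rewrite /loc_mul; have [v vp] := loc_reprP b t; have [u up] := loc_reprP a s.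
move: (loc_num (loc_frac a s)) (loc_den (loc_frac a s)) => a' s' e.
move: (loc_num (loc_frac b t)) (loc_den (loc_frac b t)) => b' t' e'.
apply/loc_fracP; exists (u * v); rewrite ?prime_idealM //= !rmorphM.
transitivity (f v * f (\val t) * b' * (f u * (f (\val s) * a' - f (\val s') * a))
 + f u * f (\val s') * a * (f v * (f (\val t) * b' - f (\val t') * b))).
  by ring.
by rewrite e e' !mulr0 addr0.
Qed.

Lemma loc_eq1 a s b t : f (\val t) * a = f (\val s) * b -> loc_frac a s = loc_frac b t.
Proof.
by move=> e; apply/loc_fracP; exists 1; rewrite ?prime_ideal1 // e subrr mulr0.
Qed.

Lemma loc_addA : associative loc_add.
Proof.
elim/loc_ind=> a s; elim/loc_ind=> b t; elim/loc_ind=> c r.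
by rewrite !loc_addE; apply: loc_eq1; rewrite /= !rmorphM; ring.
Qed.

Lemma loc_addC : commutative loc_add.
Proof.
elim/loc_ind=> a s; elim/loc_ind=> b t.
by rewrite !loc_addE; apply: loc_eq1; rewrite /= !rmorphM; ring.
Qed.

Lemma loc_add0 : left_id loc_zero loc_add.
Proof.
elim/loc_ind=> a s.
by rewrite !loc_addE; apply: loc_eq1; rewrite /= !rmorphM rmorph1; ring.
Qed.

Lemma loc_addN : left_inverse loc_zero loc_opp loc_add.
Proof.
elim/loc_ind=> a s.
by rewrite loc_oppE !loc_addE; apply: loc_eq1; rewrite /= !rmorphM rmorph1; ring.
Qed.

HB.instance Definition _ :=
  GRing.isZmodule.Build localization loc_addA loc_addC loc_add0 loc_addN.

Lemma loc_mulA : associative loc_mul.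
Proof.
elim/loc_ind=> a s; elim/loc_ind=> b t; elim/loc_ind=> c r.
by rewrite !loc_mulE; apply: loc_eq1; rewrite /= !rmorphM; ring.
Qed.

Lemma loc_mulC : commutative loc_mul.
Proof.
elim/loc_ind=> a s; elim/loc_ind=> b t.
by rewrite !loc_mulE; apply: loc_eq1; rewrite /= !rmorphM; ring.
Qed.

Lemma loc_mul1 : left_id loc_one loc_mul.
Proof.
elim/loc_ind=> a s.
by rewrite !loc_mulE; apply: loc_eq1; rewrite /= !rmorphM rmorph1; ring.
Qed.

Lemma loc_mulDl : left_distributive loc_mul loc_add.
Proof.
elim/loc_ind=> a s; elim/loc_ind=> b t; elim/loc_ind=> c r.
rewrite loc_addE !loc_mulE loc_addE.
by apply: loc_eq1; rewrite /= !rmorphM; ring.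
Qed.

HB.instance Definition _ := GRing.Zmodule_isComPzRing.Build localization
  loc_mulA loc_mulC loc_mul1 loc_mulDl.

Definition loc_map (r : R) : localization := loc_frac (f r) frac_den1.

Lemma loc_map_zmod_morphism : zmod_morphism loc_map.
Proof.
move=> x y; rewrite /loc_map -[RHS]/(loc_add _ (loc_opp _)) loc_oppE loc_addE.
by apply: loc_eq1; rewrite /= !rmorphM rmorph1 rmorphB; ring.
Qed.
HB.instance Definition _ :=
  GRing.isZmodMorphism.Build R localization loc_map loc_map_zmod_morphism.

Lemma loc_map_monoid_morphism : monoid_morphism loc_map.
Proof.
split=> [|x y]; first by rewrite /loc_map rmorph1.
rewrite /loc_map -[RHS]/(loc_mul _ _) loc_mulE.
by apply: loc_eq1; rewrite /= !rmorphM rmorph1; ring.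
Qed.
HB.instance Definition _ :=
  GRing.isMonoidMorphism.Build R localization loc_map loc_map_monoid_morphism.

Definition loc_algebra : algebra R := @Algebra R localization loc_map.

End Localization.

Definition dprod (Q : nat -> comPzRingType) : Type := forall l, Q l.

Section DepProduct.
Variable Q : nat -> comPzRingType.
HB.instance Definition _ := Choice.copy (dprod Q) (forall l, Q l).
Implicit Types x y z : dprod Q.

Definition dprod_zero : dprod Q := fun=> 0.
Definition dprod_one : dprod Q := fun=> 1.
Definition dprod_opp x : dprod Q := fun l => - x l.
Definition dprod_add x y : dprod Q := fun l => x l + y l.
Definition dprod_mul x y : dprod Q := fun l => x l * y l.

Lemma dprod_addA : associative dprod_add.
Proof. by move=> x y z; apply: functional_extensionality_dep => l; apply: addrA. Qed.
Lemma dprod_addC : commutative dprod_add.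
Proof. by move=> x y; apply: functional_extensionality_dep => l; apply: addrC. Qed.
Lemma dprod_add0 : left_id dprod_zero dprod_add.
Proof. by move=> x; apply: functional_extensionality_dep => l; apply: add0r. Qed.
Lemma dprod_addN : left_inverse dprod_zero dprod_opp dprod_add.
Proof. by move=> x; apply: functional_extensionality_dep => l; apply: addNr. Qed.
HB.instance Definition _ :=
  GRing.isZmodule.Build (dprod Q) dprod_addA dprod_addC dprod_add0 dprod_addN.

Lemma dprod_mulA : associative dprod_mul.
Proof. by move=> x y z; apply: functional_extensionality_dep => l; apply: mulrA. Qed.
Lemma dprod_mulC : commutative dprod_mul.
Proof. by move=> x y; apply: functional_extensionality_dep => l; apply: mulrC. Qed.
Lemma dprod_mul1 : left_id dprod_one dprod_mul.
Proof. by move=> x; apply: functional_extensionality_dep => l; apply: mul1r. Qed.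
Lemma dprod_mulDl : left_distributive dprod_mul dprod_add.
Proof. by move=> x y z; apply: functional_extensionality_dep => l; apply: mulrDl. Qed.
HB.instance Definition _ := GRing.Zmodule_isComPzRing.Build (dprod Q)
  dprod_mulA dprod_mulC dprod_mul1 dprod_mulDl.

End DepProduct.

Section Completion.
Variables (R : comPzRingType) (p : ideal R) (A : algebra R).
Local Notation f := (@alg_map R A).

(* p^l A: as A is an algebra, the R-submodule of A generated by the products
   x * a with x in p^l is the ideal of A generated by the image of p^l. *)
Definition ext_pow (l : nat) : ideal A :=
  ideal_gen [set f x | x in [set x | x \in ideal_pow p l]].

Lemma ideal_pow_sub l : {subset ideal_pow p l.+1 <= ideal_pow p l}.
Proof.
move=> x /asboolP xp; apply: xp => _ [t tp ->].
rewrite big_ord_recl; apply: ideal_mull.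
by apply/asboolP => J; apply; exists (fun i => t (lift ord0 i)).
Qed.

Lemma ext_pow_sub l : {subset ext_pow l.+1 <= ext_pow l}.
Proof.
move=> x /asboolP xp; apply: xp => _ [y /= yp <-].
by apply/asboolP => J; apply; exists y => //; apply: ideal_pow_sub.
Qed.

Let tower (l : nat) : comPzRingType := ring_quot (ext_pow l).

Definition compatible : {pred dprod tower} := fun x =>
  `[< forall l, quot_trans (ext_pow l) (x l.+1) = x l >].

Lemma trans_piE l (x : A) :
  quot_trans (ext_pow l) (quot_pi (ext_pow l.+1) x) = quot_pi (ext_pow l) x.
Proof. exact/quot_transE/ext_pow_sub. Qed.

Lemma compatible_subring : subring_closed compatible.
Proof.
split=> [|x y /asboolP xc /asboolP yc|x y /asboolP xc /asboolP yc];
    apply/asboolP => l.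
- exact: (trans_piE l 1).
- rewrite -[RHS]/(x l - y l) -xc -yc.
  change ((x - y) l.+1) with (x l.+1 - y l.+1).
  rewrite -[x l.+1]quot_reprK -[y l.+1]quot_reprK -rmorphB !trans_piE.
  by rewrite rmorphB.
- rewrite -[RHS]/(x l * y l) -xc -yc.
  change ((x * y) l.+1) with (x l.+1 * y l.+1).
  rewrite -[x l.+1]quot_reprK -[y l.+1]quot_reprK -rmorphM !trans_piE.
  by rewrite rmorphM.
Qed.
HB.instance Definition _ :=
  GRing.isSubringClosed.Build (dprod tower) compatible compatible_subring.

Record completion : Type := Completion {
  completion_val : dprod tower;
  _ : completion_val \in compatible
}.
HB.instance Definition _ := [isSub for completion_val].
HB.instance Definition _ := [Choice of completion by <:].
HB.instance Definition _ :=
  GRing.SubChoice_isSubComPzRing.Build _ _ completion compatible_subring.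

Lemma completion_map_subproof (r : R) :
  ((fun l => quot_pi (ext_pow l) (f r)) : dprod tower) \in compatible.
Proof. by apply/asboolP => l; rewrite trans_piE. Qed.

Definition completion_map (r : R) : completion :=
  Completion (completion_map_subproof r).

Lemma completion_map_zmod_morphism : zmod_morphism completion_map.
Proof.
move=> x y; apply: val_inj; rewrite rmorphB /=.
by apply: functional_extensionality_dep => l; rewrite !rmorphB.
Qed.
HB.instance Definition _ := GRing.isZmodMorphism.Build R completion
  completion_map completion_map_zmod_morphism.

Lemma completion_map_monoid_morphism : monoid_morphism completion_map.
Proof.
split=> [|x y]; apply: val_inj; rewrite ?rmorph1 ?rmorphM /=;
  by apply: functional_extensionality_dep => l; rewrite ?rmorph1 ?rmorphM.
Qed.
HB.instance Definition _ := GRing.isMonoidMorphism.Build R completion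
  completion_map completion_map_monoid_morphism.

Definition completion_algebra : algebra R := @Algebra R completion completion_map.

End Completion.

Definition ideal_lt (R : comPzRingType) (I J : ideal R) : Prop :=
  {subset I <= J} /\ ~ {subset J <= I}.

Record flag (R : comPzRingType) (n : nat) := Flag {
  flag_prime :> 'I_n.+1 -> prime_ideal R;
  flag_lt : forall i : 'I_n,
    ideal_lt (flag_prime (widen_ord (leqnSn n) i)) (flag_prime (lift ord0 i))
}.

(* C_{p_0} S_{p_0}^{-1} ... C_{p_n} S_{p_n}^{-1} R, with its R-algebra structure *)
Definition indpro_completion (R : comPzRingType) (n : nat) (D : flag R n) :
    algebra R :=
  foldr (fun (p : prime_ideal R) (A : algebra R) =>
           completion_algebra p (loc_algebra p A))
        (base_algebra R) [seq D i | i <- enum 'I_n.+1].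

(* -oo for the empty set, +oo for an unbounded set *)
Definition nat_sup (N : set nat) : \bar int :=
  supremum -oo%E [set (n%:Z)%:E | n in N].

Lemma nat_sup_exists (N : set nat) :
  exists m : \bar int, supremums [set (n%:Z)%:E | n in N] m.
Proof.
have [[b Nb]|unb] := pselect (exists b, forall n, N n -> (n <= b)%N); last first.
  exists +oo%E; split=> [_ [n _ <-]|[z||] zub]; rewrite ?leey //.
    exfalso; apply: unb; exists `|z|%N => n Nn.
    have := zub _ (ex_intro2 _ _ n Nn erefl).
    by rewrite lee_fin -lez_nat => /le_trans; apply; rewrite abszE ler_norm.
  exfalso; apply: unb; exists 0%N => n Nn.
  by have := zub _ (ex_intro2 _ _ n Nn erefl).
have [[n0 Nn0]|N0] := pselect (exists n, N n); last first.
  exists -oo%E; split=> [_ [n Nn <-]|z _]; rewrite ?leNye //.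
  by exfalso; apply: N0; exists n.
have exN : exists n, `[< N n >] by exists n0; apply/asboolP.
have ubN n : `[< N n >] -> (n <= b)%N by move/asboolP/Nb.
case: (ex_maxnP exN ubN) => k /asboolP Nk kmax.
exists (k%:Z)%:E; split=> [_ [n Nn <-]|z]; last by apply; exists k.
by rewrite lee_fin lez_nat kmax //; apply/asboolP.
Qed.

Lemma nat_supP (N : set nat) (m : \bar int) :
  (nat_sup N <= m)%E <-> (forall n, N n -> ((n%:Z)%:E <= m)%E).
Proof.
rewrite /nat_sup /supremum; case: ifPn => [/eqP N0|_].
  split=> [_ n Nn|_]; last exact: leNye.
  by have : set0 (n%:Z)%:E by rewrite -N0; exists n.
have [s ss] := nat_sup_exists N.
case: xgetP => [y -> [ub lub]|/(_ s)/(_ ss)[]]; split=> [le_m n Nn|Nm].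
  by apply: le_trans le_m; apply: ub; exists n.
by apply: lub => _ [n Nn <-]; apply: Nm.
Qed.

Definition krull_dim (A : comPzRingType) : \bar int :=
  nat_sup [set n | inhabited (flag A n)].

Definition height (R : comPzRingType) (p : prime_ideal R) : \bar int :=
  nat_sup [set n | exists D : flag R n, D ord_max =i p].

Section QuotientFlag.
Variable R : comPzRingType.

Section QuotientPrime.
Variables (q p : prime_ideal R) (qp : {subset q <= p}).

(* The unused argument is there for the instances below to be inferred. *)
Definition quot_ideal (_ : {subset q <= p}) : {pred ring_quot q} :=
  fun y => `[< exists2 x, x \in p & y = quot_pi q x >].

Local Notation pq := (quot_ideal qp).

Lemma quot_idealE x : (quot_pi q x \in pq) = (x \in p).
Proof.
apply/asboolP/idP => [[y yp /eqP]|xp]; last by exists x.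
by rewrite quot_piE => /qp xyp; rewrite -(subrK y x) rpredD.
Qed.

Lemma quot_ideal_zmod_closed : zmod_closed pq.
Proof.
split=> [|x y]; first by rewrite -(rmorph0 (quot_pi q)) quot_idealE rpred0.
rewrite -[x]quot_reprK -[y]quot_reprK -rmorphB !quot_idealE.
exact: rpredB.
Qed.
HB.instance Definition _ :=
  GRing.isZmodClosed.Build _ (quot_ideal qp) quot_ideal_zmod_closed.

Lemma quot_ideal_mul a : {in pq, forall u, a * u \in pq}.
Proof.
move=> u; rewrite -[a]quot_reprK -[u]quot_reprK -rmorphM !quot_idealE.
exact: ideal_mull.
Qed.
HB.instance Definition _ := isIdeal.Build _ (quot_ideal qp) quot_ideal_mul.

Lemma quot_ideal1 : 1 \notin pq.
Proof. by rewrite -(rmorph1 (quot_pi q)) quot_idealE prime_ideal1. Qed.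

Lemma quot_idealM u v : u * v \in pq -> (u \in pq) || (v \in pq).
Proof.
rewrite -[u]quot_reprK -[v]quot_reprK -rmorphM !quot_idealE.
exact: prime_subproofM.
Qed.
HB.instance Definition _ :=
  isPrime.Build _ (quot_ideal qp) quot_ideal1 quot_idealM.

Definition quot_prime : prime_ideal (ring_quot q) := quot_ideal qp.

End QuotientPrime.

Variables (n : nat) (D : flag R n).

Lemma flag_head_sub i : {subset D ord0 <= D i}.
Proof.
case: i; elim=> [|i IH] lt_in x xD.
  by rewrite (_ : Ordinal lt_in = ord0) //; apply: val_inj.
have [+ _] := flag_lt D (Ordinal (lt_in : (i < n)%N)).
have -> : lift ord0 (Ordinal (lt_in : (i < n)%N)) = Ordinal lt_in
  by apply: val_inj.
apply.
have -> : widen_ord (leqnSn n) (Ordinal (lt_in : (i < n)%N)) =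
  Ordinal (ltnW lt_in) by apply: val_inj.
exact: IH.
Qed.

Lemma quot_flag_subproof (i : 'I_n) :
  ideal_lt (quot_prime (@flag_head_sub (widen_ord (leqnSn n) i)))
           (quot_prime (@flag_head_sub (lift ord0 i))).
Proof.
have [sub nsub] := flag_lt D i; split=> [y|H].
  rewrite -[y]quot_reprK !quot_idealE; exact: sub.
by apply: nsub => x xD; have := H (quot_pi _ x); rewrite !quot_idealE; apply.
Qed.

Definition quot_flag : flag (ring_quot (D ord0)) n :=
  @Flag _ n (fun i => quot_prime (@flag_head_sub i)) quot_flag_subproof.

End QuotientFlag.

(* Main.v *)
(* Write A for the completion and f : R -> A for its structure map.  A is
   Noetherian, flat over R, A / p_0 A is the completion of R / p_0, the elements of R
   outside p_0 are invertible in A, and p_0 A lies in the Jacobson radical.  Hence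
   every prime of A is contained in one above p_0, and every prime of A that
   contains p_0 A contracts to p_0.
   Lower bound: a chain of primes of A containing p_0 A is extended downwards, by
   going down, along a chain of primes of R ending at p_0.
   Upper bound: let Q_0 < ... < Q_k be a chain in A with Q_k above p_0.  If Q_0 does
   not contain p_0 A, choose r in p_0 with f(r) outside Q_0; by the principal ideal
   theorem there is a chain Q_1' < ... < Q_k above Q_0, one step shorter, with
   f(r) in Q_1', and the contraction to R strictly increases.  Repeating this
   splits k into the length of a chain of R ending at p_0 and that of a chain of
   primes of A containing p_0 A. *)
From HB Require Import structures.
Require Import Defs.
From mathcomp Require Import all_boot all_order all_algebra.
From mathcomp Require Import boolp classical_sets.
From mathcomp Require Import constructive_ereal.
From mathcomp Require Import ring zify.

Set Implicit Arguments.
Unset Strict Implicit.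
Unset Printing Implicit Defensive.

Import Order.TTheory GRing.Theory Num.Theory.
Local Open Scope classical_set_scope.
Local Open Scope ring_scope.

(** * Ideals *)

(** Flatness enters only through ideals: [ideal_flat] records that extension from R commutes with
    intersections and with colons by an element, and this survives localization and completion
    without any module or tensor product. Every stage A of the tower remains an R-algebra filtered
    by the ideals p^l A extended from R, so Artin-Rees is used in R alone and then extended to A.
    The obstacle is completion. Its flatness and its reduction modulo p_0 are proved by
    approximation, because an extended ideal K T of the completion T is closed; its Noetherianity
    comes from an ideal maximal among those that are not finitely generated. Localization at a prime
    inside the arguments on ideals is replaced by the saturation [ideal_sat], so that Nakayama's
    lemma and the principal ideal theorem need no local ring. The tower over R / p_0 is reached from
    the tower over R by surjections built stage by stage. *)

Section IdealOf.
Variables (R : comPzRingType) (P : R -> Prop).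

Definition ideal_of_pred (_ : P 0) (_ : forall x y, P x -> P y -> P (x - y))
    (_ : forall a x, P x -> P (a * x)) : {pred R} :=
  fun x => `[< P x >].

Variables (P0 : P 0) (PB : forall x y, P x -> P y -> P (x - y))
  (PM : forall a x, P x -> P (a * x)).

Lemma ideal_of_zmod_closed : zmod_closed (ideal_of_pred P0 PB PM).
Proof.
by split=> [|x y /asboolP Px /asboolP Py]; apply/asboolP; [|exact: PB].
Qed.
HB.instance Definition _ := GRing.isZmodClosed.Build R
  (ideal_of_pred P0 PB PM) ideal_of_zmod_closed.

Lemma ideal_of_mul a :
  {in ideal_of_pred P0 PB PM, forall u, a * u \in ideal_of_pred P0 PB PM}.
Proof. by move=> u /asboolP Pu; apply/asboolP/PM. Qed.
HB.instance Definition _ :=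
  isIdeal.Build R (ideal_of_pred P0 PB PM) ideal_of_mul.

Definition ideal_of : ideal R := ideal_of_pred P0 PB PM.

Lemma in_ideal_of x : x \in ideal_of <-> P x.
Proof. by split=> [/asboolP|?]; [|apply/asboolP]. Qed.

End IdealOf.

Section PrimeOf.
Variables (R : comPzRingType) (J : ideal R).

Definition prime_of_pred (_ : 1 \notin J)
    (_ : forall u v, u * v \in J -> (u \in J) || (v \in J)) : {pred R} := J.

Variables (J1 : 1 \notin J)
  (JM : forall u v, u * v \in J -> (u \in J) || (v \in J)).

HB.instance Definition _ := Ideal.copy (prime_of_pred J1 JM) J.
HB.instance Definition _ := isPrime.Build R (prime_of_pred J1 JM) J1 JM.

Definition prime_of : prime_ideal R := prime_of_pred J1 JM.

End PrimeOf.

Section Ideals.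
Variable R : comPzRingType.
Implicit Types (I J K : ideal R) (S : set R) (s : seq R) (p : prime_ideal R).

Lemma ideal_gen_in S x : S x -> x \in ideal_gen S.
Proof. by move=> Sx; apply/asboolP => I; apply. Qed.

Lemma ideal_gen_le S I :
  (forall x, S x -> x \in I) -> {subset ideal_gen S <= I}.
Proof. by move=> SI x /asboolP; apply. Qed.

(** Many ideals below are written as [ideal_gen] of a set that is already closed, which provides the
    ideal structure for free; their membership criterion is recovered here. *)
Lemma ideal_gen_id S : S 0 -> (forall x y, S x -> S y -> S (x - y)) ->
  (forall a x, S x -> S (a * x)) -> forall x, x \in ideal_gen S <-> S x.
Proof.
move=> S0 SB SM x; split; last exact: ideal_gen_in.
move=> xS; apply/(in_ideal_of S0 SB SM); move: x xS.
by apply: ideal_gen_le => x Sx; apply/in_ideal_of.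
Qed.

Definition ideal_add I J : ideal R :=
  ideal_gen [set x | exists2 i, i \in I & x - i \in J].

Lemma in_ideal_add I J x :
  x \in ideal_add I J <-> exists2 i, i \in I & x - i \in J.
Proof.
apply: ideal_gen_id => {x} [|x y [i iI xiJ] [j jI yjJ]|a x [i iI xiJ]].
- by exists 0; rewrite ?subrr ?rpred0.
- exists (i - j); first exact: rpredB.
  have -> : x - y - (i - j) = (x - i) - (y - j) by ring.
  by rewrite rpredB.
- by exists (a * i); rewrite -?mulrBr ideal_mull.
Qed.

Lemma ideal_addl I J : {subset I <= ideal_add I J}.
Proof. by move=> x xI; apply/in_ideal_add; exists x; rewrite ?subrr ?rpred0. Qed.

Lemma ideal_addr I J : {subset J <= ideal_add I J}.
Proof. by move=> x xJ; apply/in_ideal_add; exists 0; rewrite ?subr0 ?rpred0. Qed.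

Definition ideal_cap I J : ideal R :=
  ideal_gen [set x | x \in I /\ x \in J].

Lemma in_ideal_cap I J x : x \in ideal_cap I J <-> x \in I /\ x \in J.
Proof.
apply: ideal_gen_id => {x} [|x y [xI xJ] [yI yJ]|a x [xI xJ]].
- by split; apply: rpred0.
- by split; apply: rpredB.
- by split; apply: ideal_mull.
Qed.

Definition ideal_colon J (x : R) : ideal R := ideal_gen [set a | x * a \in J].

Lemma in_ideal_colon J (x a : R) : a \in ideal_colon J x <-> x * a \in J.
Proof.
apply: ideal_gen_id => {a} [|a b /= aJ bJ|b a /= aJ].
- by rewrite /= mulr0 rpred0.
- by rewrite mulrBr rpredB.
- by rewrite mulrCA ideal_mull.
Qed.

Lemma ideal_colon_sub J x : {subset J <= ideal_colon J x}.
Proof. by move=> a aJ; apply/in_ideal_colon/ideal_mull. Qed.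

(* The contraction to R of the extension of J to the localization at p. *)
Definition ideal_sat p J : ideal R :=
  ideal_gen [set a | exists2 t, t \notin p & t * a \in J].

Lemma in_ideal_sat p J a :
  a \in ideal_sat p J <-> exists2 t, t \notin p & t * a \in J.
Proof.
apply: ideal_gen_id => {a} [|a b [t tp ta] [u up ub]|b a [t tp ta]].
- by exists 1; rewrite ?prime_ideal1 // mulr0 rpred0.
- exists (t * u); first exact: prime_idealM.
  have -> : t * u * (a - b) = u * (t * a) - t * (u * b) by ring.
  by apply: rpredB; apply: ideal_mull.
- by exists t; rewrite // mulrCA ideal_mull.
Qed.

Lemma ideal_sat_sub p J : {subset J <= ideal_sat p J}.
Proof.
by move=> a aJ; apply/in_ideal_sat; exists 1; rewrite ?prime_ideal1 // mul1r.
Qed.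

Lemma ideal_sat_sat p J t a :
  t \notin p -> t * a \in ideal_sat p J -> a \in ideal_sat p J.
Proof.
move=> tp /in_ideal_sat[u up uta]; apply/in_ideal_sat; exists (u * t).
  exact: prime_idealM.
by rewrite -mulrA.
Qed.

Lemma ideal_sat_mono p I J :
  {subset I <= J} -> {subset ideal_sat p I <= ideal_sat p J}.
Proof.
move=> IJ a /in_ideal_sat[t tp ta]; apply/in_ideal_sat.
by exists t; rewrite ?IJ.
Qed.

Definition ideal_mul I J : ideal R :=
  ideal_gen [set x | exists i j, [/\ i \in I, j \in J & x = i * j]].

Lemma ideal_mul_in I J i j : i \in I -> j \in J -> i * j \in ideal_mul I J.
Proof. by move=> iI jJ; apply: ideal_gen_in; exists i, j. Qed.

Lemma ideal_mul_le I J K :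
  (forall i j, i \in I -> j \in J -> i * j \in K) -> {subset ideal_mul I J <= K}.
Proof. by move=> IJK; apply: ideal_gen_le => _ [i [j [iI jJ ->]]]; apply: IJK. Qed.

Lemma ideal_mul_subr I J : {subset ideal_mul I J <= J}.
Proof. by apply: ideal_mul_le => i j _; apply: ideal_mull. Qed.

Lemma ideal_mul_subl I J : {subset ideal_mul I J <= I}.
Proof. by apply: ideal_mul_le => i j ? _; apply: ideal_mulr. Qed.

Lemma ideal_mul_mono I J I' J' : {subset I <= I'} -> {subset J <= J'} ->
  {subset ideal_mul I J <= ideal_mul I' J'}.
Proof. by move=> II JJ; apply: ideal_mul_le => i j /II ? /JJ; apply: ideal_mul_in. Qed.

(** For fixed i, the x with i x in the target form a colon ideal, so testing generators suffices.
    Products of generated ideals are bounded in this way throughout. *)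
Lemma ideal_mulA I J K :
  {subset ideal_mul I (ideal_mul J K) <= ideal_mul (ideal_mul I J) K}.
Proof.
apply: ideal_mul_le => i x iI xJK; apply/in_ideal_colon; move: x xJK.
apply: ideal_mul_le => j k jJ kK; apply/in_ideal_colon.
by rewrite mulrA !ideal_mul_in.
Qed.

Definition span s : ideal R := ideal_gen [set x | x \in s].

Lemma span_in s x : x \in s -> x \in span s.
Proof. exact: ideal_gen_in. Qed.

Lemma span_le s I : {in s, forall x, x \in I} -> {subset span s <= I}.
Proof. exact: ideal_gen_le. Qed.

Lemma in_span s x :
  x \in span s <-> exists c : nat -> R, x = \sum_(i < size s) c i * s`_i.
Proof.
split; last first.
  by move=> [c ->]; apply: rpred_sum => i _; apply/ideal_mull/span_in/mem_nth.
move=> xs; apply/(@ideal_gen_id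
  [set x | exists c : nat -> R, x = \sum_(i < size s) c i * s`_i]).
- by exists (fun=> 0); rewrite big1 // => i _; rewrite mul0r.
- move=> _ _ [c ->] [d ->]; exists (fun i => c i - d i).
  by rewrite -sumrB; apply: eq_bigr => i _; rewrite mulrBl.
- move=> a _ [c ->]; exists (fun i => a * c i).
  by rewrite mulr_sumr; apply: eq_bigr => i _; rewrite mulrA.
move: x xs; apply: span_le => x xs; apply: ideal_gen_in.
have ix : (index x s < size s)%N by rewrite index_mem.
exists (fun i => (i == index x s)%:R); rewrite (bigD1 (Ordinal ix)) //=.
rewrite eqxx mul1r nth_index // big1 ?addr0 // => i /negPf ne.
by rewrite (_ : _ == _ = false) ?mul0r //; rewrite -ne -val_eqE.
Qed.

Lemma in_span_cons g s x : x \in span (g :: s) <-> exists c, x - c * g \in span s.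
Proof.
split; last first.
  move=> [c xcg]; rewrite -(subrK (c * g) x) rpredD //; last exact/ideal_mull/span_in/mem_head.
  by move: xcg; apply: span_le => y ys; rewrite span_in // in_cons ys orbT.
move=> /in_span[c ->]; rewrite big_ord_recl; exists (c 0%N).
rewrite addrC addKr; apply: rpred_sum => i _; apply/ideal_mull/span_in.
exact: mem_nth.
Qed.

Lemma in_span1 g x : x \in span [:: g] <-> exists c, x = c * g.
Proof.
split=> [/in_span_cons[c /in_span[d]]|[c ->]]; last first.
  by apply/ideal_mull/span_in/mem_head.
by rewrite big_ord0 => /eqP; rewrite subr_eq0 => /eqP; exists c.
Qed.

Lemma span_catl s1 s2 : {subset span s1 <= span (s1 ++ s2)}.
Proof. by apply: span_le => x xs; rewrite span_in // mem_cat xs. Qed.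

Lemma span_catr s1 s2 : {subset span s2 <= span (s1 ++ s2)}.
Proof. by apply: span_le => x xs; rewrite span_in // mem_cat xs orbT. Qed.

Definition fin_gen I : Prop := exists s, I =i span s.

Lemma ideal_pow0 I x : x \in ideal_pow I 0.
Proof.
rewrite -[x]mulr1; apply/ideal_mull/ideal_gen_in.
by exists (fun=> 0); [case|rewrite big_ord0].
Qed.

Lemma ideal_powS I l : ideal_pow I l.+1 =i ideal_mul I (ideal_pow I l).
Proof.
move=> x; apply/idP/idP; move: x; last first.
  apply: ideal_mul_le => i x iI xl; apply/in_ideal_colon; move: x xl.
  apply: ideal_gen_le => _ [t tI ->]; apply/in_ideal_colon/ideal_gen_in.
  exists (fun j : 'I_l.+1 => if unlift ord0 j is Some k then t k else i).
    by move=> j; case: unliftP.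
  rewrite big_ord_recl; case: unliftP => // _; congr (_ * _).
  by apply: eq_bigr => k _; rewrite liftK.
apply: ideal_gen_le => _ [t tI ->]; rewrite big_ord_recl; apply: ideal_mul_in => //.
by apply: ideal_gen_in; exists (fun i => t (lift ord0 i)).
Qed.

Lemma ideal_pow_leq I l m : (l <= m)%N -> {subset ideal_pow I m <= ideal_pow I l}.
Proof.
move=> /subnKC <-; elim: (m - l)%N => [|k IH] x; first by rewrite addn0.
by rewrite addnS ideal_powS => /ideal_mul_subr/IH.
Qed.

Lemma ideal_pow_exp I x l : x \in I -> x ^+ l \in ideal_pow I l.
Proof.
move=> xI; elim: l => [|l IH]; first exact: ideal_pow0.
by rewrite ideal_powS exprS ideal_mul_in.
Qed.

Lemma ideal_pow_prime I p l : {subset ideal_pow I l <= p} -> {subset I <= p}.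
Proof.
move=> Ilp x xI; have := Ilp _ (ideal_pow_exp l xI).
elim: l {Ilp} => [|l IH]; first by rewrite (negPf (prime_ideal1 p)).
by rewrite exprS => /prime_subproofM/orP[].
Qed.

Lemma prime_prod (p : prime_ideal R) x y : x * y \in p -> x \notin p -> y \in p.
Proof. by move=> /prime_subproofM/orP[->|]. Qed.

Definition ideal_chain (C : ideal R -> Prop) : Prop := (exists I, C I) /\
  forall I J, C I -> C J -> {subset I <= J} \/ {subset J <= I}.

Definition chain_union (C : ideal R -> Prop) : ideal R :=
  ideal_gen [set x | exists2 I : ideal R, C I & x \in I].

(** Zorn's lemma is run on the sets of elements of the ideals in [F], preordered by inclusion.
    Besides [noetherian_max], it serves the completion before that ring is known to be
    Noetherian. *)
Lemma ideal_zorn (F : ideal R -> Prop) : (exists I, F I) ->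
  (forall C, ideal_chain C -> (forall I, C I -> F I) -> F (chain_union C)) ->
  exists M, F M /\ forall J, F J -> {subset M <= J} -> {subset J <= M}.
Proof.
move=> [I0 FI0] FU.
pose G (A : set R) := exists2 I : ideal R, F I & A = [set x | x \in I].
have GF (I : ideal R) : F I -> G [set x | x \in I] by exists I.
pose le (A B : {A | G A}) := `[< sval A `<=` sval B >].
have [|A B K /asboolP AB /asboolP BK|C Ctot|[A [M FM AM]] Mmax] :=
    @ZL_preorder {A | G A} (exist _ _ (GF _ FI0)) le.
- by move=> A; apply/asboolP.
- by apply/asboolP => x /AB/BK.
- have [[A CA]|C0] := pselect (exists A, C A); last first.
    by exists (exist _ _ (GF _ FI0)) => A CA; exfalso; apply: C0; exists A.
  pose C' (I : ideal R) := F I /\ exists2 A, C A & sval A = [set x | x \in I].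
  have FU' : F (chain_union C').
    apply: FU => [|I []//]; split.
      by case: (svalP A) => I FI AI; exists I; split=> //; exists A.
    move=> I J [_ [B CB BI]] [_ [K CK KJ]].
    by case: (Ctot _ _ CB CK) => /asboolP; rewrite BI KJ; [left|right].
  exists (exist _ _ (GF _ FU')) => B CB; apply/asboolP => x Bx /=.
  case: (svalP B) => I FI BI; apply: ideal_gen_in; exists I; last by rewrite BI in Bx.
  by split=> //; exists B.
exists M; split=> // J FJ MJ x xJ.
have AJ : A `<=` [set x | x \in J] by rewrite AM.
have /asboolP /(_ x xJ) /= := Mmax (exist _ _ (GF _ FJ)) (asboolT AJ).
by rewrite AM.
Qed.

Lemma in_chain_union C : ideal_chain C ->
  forall x, x \in chain_union C <-> exists2 I, C I & x \in I.
Proof.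
move=> [[I0 CI0] Ctot]; apply: ideal_gen_id => [|x y [I CI xI] [J CJ yJ]|a x [I CI xI]].
- by exists I0; rewrite ?rpred0.
- by have [IJ|JI] := Ctot _ _ CI CJ; [exists J|exists I] => //; apply: rpredB; auto.
- by exists I => //; apply: ideal_mull.
Qed.

Lemma chain_union_span C s : ideal_chain C ->
  {subset span s <= chain_union C} -> exists2 I, C I & {subset span s <= I}.
Proof.
move=> Cc sU.
have {sU}: {in s, forall x, exists2 I, C I & x \in I}.
  by move=> x xs; apply/(in_chain_union Cc)/sU/span_in.
elim: s => [|x s IH] sU.
  by case: Cc => [[I CI] _]; exists I => //; apply: span_le.
have [|I CI sI] := IH; first by move=> y ys; apply: sU; rewrite in_cons ys orbT.
have [J CJ xJ] := sU _ (mem_head x s).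
have [IJ|JI] := Cc.2 _ _ CI CJ; [exists J|exists I] => //;
  apply: span_le => y; rewrite in_cons => /orP[/eqP->|/span_in/sI]; auto.
Qed.

(** The union of a chain, being finitely generated, agrees with a member only elementwise, and [F]
    need not respect such agreement. Zorn's lemma is therefore applied to the ideals with the same
    elements as some ideal in [F]. *)
Lemma noetherian_max (F : ideal R -> Prop) : noetherian R -> (exists I, F I) ->
  exists M, F M /\ forall J, F J -> {subset M <= J} -> {subset J <= M}.
Proof.
move=> nR exF; pose G (I : ideal R) := exists2 J : ideal R, F J & I =i J.
have [||M [[M' FM' MM'] Mmax]] := @ideal_zorn G.
- by have [I FI] := exF; exists I, I.
- move=> C Cc CG; have [s Us] := nR (chain_union C).
  have [|I CI sI] := @chain_union_span C s Cc.
    by move=> x; rewrite Us.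
  have [J FJ IJ] := CG _ CI; exists J => // x; rewrite -IJ; apply/idP/idP.
    by rewrite Us => /sI.
  by move=> xI; apply: ideal_gen_in; exists I.
exists M'; split=> // J FJ MJ x xJ; rewrite -MM'; apply: Mmax xJ.
  by exists J.
by move=> y; rewrite MM' => /MJ.
Qed.

Lemma noetherian_chain (J : nat -> ideal R) : noetherian R ->
  (forall l, {subset J l <= J l.+1}) -> exists l, {subset J l.+1 <= J l}.
Proof.
move=> nR Jinc; have [|M [[l ->] Mmax]] := @noetherian_max (fun I => exists l, I = J l) nR.
  by exists (J 0%N), 0%N.
by exists l; apply: Mmax; [exists l.+1|].
Qed.

(* An ideal maximal among those that contain J and miss T is prime. *)
Lemma exists_prime J (T : set R) : noetherian R -> T 1 ->
  (forall x y, T x -> T y -> T (x * y)) -> (forall x, T x -> x \notin J) ->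
  exists P : prime_ideal R, {subset J <= P} /\ forall x, T x -> x \notin P.
Proof.
move=> nR T1 TM TJ.
pose F (I : ideal R) := {subset J <= I} /\ forall x, T x -> x \notin I.
have [|M [[JM TJM] Mmax]] := @noetherian_max F nR; first by exists J; split.
have key u : u \notin M -> exists2 t, T t & t \in ideal_add M (span [:: u]).
  move=> uM; apply: contrapT => noT; move/negP: uM; apply.
  apply: (Mmax (ideal_add M (span [:: u]))).
  - split=> [x /JM|x Tx]; first exact: ideal_addl.
    by apply/negP => xM; apply: noT; exists x.
  - exact: ideal_addl.
  - by apply/ideal_addr/span_in/mem_head.
have MM u v : u * v \in M -> (u \in M) || (v \in M).
  move=> uvM; apply: contrapT => /negP; rewrite negb_or => /andP[].
  move=> /key[t Tt /in_ideal_add[m mM tmu]] /key[t' Tt' /in_ideal_add[m' mM' tmv]].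
  suff: t * t' \in M by apply/negP/(TJM _ (TM _ _ Tt Tt')).
  have [c ec] := (in_span1 _ _).1 tmu; have [d ed] := (in_span1 _ _).1 tmv.
  have -> : t * t' = t' * m + c * u * m' + c * d * (u * v).
    by rewrite -[t](subrK m) -[t'](subrK m') ec ed; ring.
  by do !apply: rpredD; apply: ideal_mull.
by exists (prime_of (TJM _ T1) MM).
Qed.

End Ideals.

(** * Artin-Rees and the principal ideal theorem *)

Section Noetherian.
Variables (R : comPzRingType) (nR : noetherian R).
Implicit Types (I J K L M : ideal R) (p P Q : prime_ideal R) (s : seq R).

(** By induction on the generators: a product of a + b elements of (g) + (s) lies in (s)^a + (g^b),
    where a and b are the exponents that work for s and for g. *)
Lemma span_pow_sub L s : {in s, forall g, exists m, g ^+ m \in L} ->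
  exists m, {subset ideal_pow (span s) m <= L}.
Proof.
elim: s => [|g s IH] sL.
  exists 1%N => x; rewrite ideal_powS => /ideal_mul_subl; move: x.
  exact: span_le.
have [|m mL] := IH; first by move=> y ys; apply: sL; rewrite in_cons ys orbT.
have [n gn] := sL _ (mem_head g s).
suff pow_sub k a b : k = (a + b)%N -> {subset ideal_pow (span (g :: s)) k <=
    ideal_add (ideal_pow (span s) a) (span [:: g ^+ b])}.
  exists (m + n)%N => x /(pow_sub _ m n erefl)/in_ideal_add[y ym].
  move=> /in_span1[c e]; rewrite -(subrK y x) e; apply: rpredD; last exact: mL.
  exact: ideal_mull.
elim: k a b => [|k IHk] [|a] [|b] // e x;
  try by [move=> _; apply/ideal_addl/ideal_pow0 |
          move=> _; apply/ideal_addr; rewrite -[x]mulr1; apply/ideal_mull/span_in/mem_head].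
rewrite ideal_powS; move: x; apply: ideal_mul_le => i y /in_span_cons[c ic] yk.
have e1 : k = (a + b.+1)%N by lia.
have e2 : k = (a.+1 + b)%N by lia.
(* [y] is decomposed twice: [i - c * g] lies in [span s] and supplies the missing factor to [u],
   whereas [c * g] supplies the missing factor [g] next to [v]. *)
have /in_ideal_add[u ua /in_span1[d yu]] := IHk a b.+1 e1 y yk.
have /in_ideal_add[v va /in_span1[d' yv]] := IHk a.+1 b e2 y yk.
have -> : i * y = ((i - c * g) * u + c * g * v) + ((i - c * g) * d + c * d') * g ^+ b.+1.
  have ->: i * y = (i - c * g) * (y - u + u) + c * g * (y - v + v) by ring.
  by rewrite yu yv exprS; ring.
apply: rpredD.
  apply: ideal_addl; apply: rpredD; last exact: ideal_mull.
  by rewrite ideal_powS; apply: ideal_mul_in.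
by apply/ideal_addr/ideal_mull/span_in/mem_head.
Qed.

Lemma ideal_pow_sub_nil I L : (forall a, a \in I -> exists m, a ^+ m \in L) ->
  exists m, {subset ideal_pow I m <= L}.
Proof.
move=> IL; have [s sI] := nR I.
have [|m mL] := @span_pow_sub L s; first by move=> a /span_in as_; apply/IL; rewrite sI.
exists m; suff powE l : {subset ideal_pow I l <= ideal_pow (span s) l}.
  by move=> x /powE/mL.
elim: l => [|l IHl] x; first by move=> _; apply: ideal_pow0.
rewrite !ideal_powS; by apply: ideal_mul_mono => // y; rewrite sI.
Qed.

(* For L maximal with L \cap K = I K, each (L : a^n) with a in I stabilizes,
   and then adding a^n to L does not enlarge L \cap K. *)
Lemma artin_rees1 I K :
  exists m, forall x, x \in K -> x \in ideal_pow I m -> x \in ideal_mul I K.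
Proof.
pose F L := {subset ideal_mul I K <= L} /\
  forall x, x \in L -> x \in K -> x \in ideal_mul I K.
have [|L [[IKL LK] Lmax]] := @noetherian_max _ F nR; first by exists (ideal_mul I K); split.
have [|m mL] := @ideal_pow_sub_nil I L; last by exists m => x xK /mL/LK; apply.
move=> a aI; have [|n nL] := @noetherian_chain _ (fun n => ideal_colon L (a ^+ n)) nR.
  move=> l x /in_ideal_colon xl; apply/in_ideal_colon.
  by rewrite exprS -mulrA ideal_mull.
exists n; apply: (Lmax (ideal_add L (span [:: a ^+ n]))); last 1 first.
- by apply/ideal_addr/span_in/mem_head.
- split=> [x /IKL|x /in_ideal_add[l lL /in_span1[b xl]] xK]; first exact: ideal_addl.
  (* The product a x lies in I K, hence in L; so b lies in (L : a^(n+1)), which is contained in (L :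
     a^n). *)
  have abL : a ^+ n.+1 * b \in L.
    have -> : a ^+ n.+1 * b = a * x - a * l.
      by rewrite -mulrBr xl exprS; ring.
    by apply: rpredB; [apply/IKL/ideal_mul_in|apply: ideal_mull].
  have /in_ideal_colon bL := nL b ((in_ideal_colon _ _ _).2 abL).
  by apply: LK => //; rewrite -(subrK l x) xl mulrC rpredD.
- exact: ideal_addl.
Qed.

(** Each use of [artin_rees1], with I^l K in place of K, gains one power of I. The conclusion, with
    m depending on l, says that the I-adic topology of K is induced from R, the form that
    completions call for. *)
Lemma artin_rees I K l : exists m, forall x,
  x \in K -> x \in ideal_pow I m -> x \in ideal_mul (ideal_pow I l) K.
Proof.
elim: l => [|l [m IHm]].
  by exists 0%N => x xK _; rewrite -[x]mul1r ideal_mul_in ?ideal_pow0.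
have [m' step] := artin_rees1 I (ideal_mul (ideal_pow I l) K).
exists (maxn m m') => x xK xm.
have xIK : x \in ideal_mul I (ideal_mul (ideal_pow I l) K).
  apply: step; last by apply: ideal_pow_leq xm; exact: leq_maxr.
  by apply: IHm => //; apply: ideal_pow_leq xm; exact: leq_maxl.
apply: ideal_mul_mono (ideal_mulA xIK) => // y.
by rewrite ideal_powS.
Qed.

Lemma in_mul_span_cons I g s x : x \in ideal_mul I (span (g :: s)) ->
  exists2 c, c \in I & x - c * g \in ideal_mul I (span s).
Proof.
move=> xI; apply/(@ideal_gen_id _ [set x |
  exists2 c, c \in I & x - c * g \in ideal_mul I (span s)]).
- by exists 0; rewrite ?mul0r ?subrr rpred0.
- move=> {xI} x y [c cI xc] [d dI yd]; exists (c - d); first exact: rpredB.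
  have -> : x - y - (c - d) * g = (x - c * g) - (y - d * g) by ring.
  exact: rpredB.
- move=> a {xI} x [c cI xc]; exists (a * c); first exact: ideal_mull.
  by rewrite -mulrA -mulrBr ideal_mull.
move: x xI; apply: ideal_mul_le => i y iI /in_span_cons[c yc]; apply: ideal_gen_in.
exists (i * c); first exact: ideal_mulr.
by rewrite -mulrA -mulrBr ideal_mul_in.
Qed.

(** Nakayama's lemma over R_p, with [ideal_sat p] in place of localization. In the relation of a
    generator, (t - c) g in p (s) + L with t outside p and c in p, the factor t - c acts as a unit,
    so generators can be removed one by one. *)
Lemma nakayama_span p s L :
  {subset span s <= ideal_sat p (ideal_add (ideal_mul p (span s)) L)} ->
  {subset span s <= ideal_sat p L}.
Proof.
elim: s => [|g s IH] sL; first exact: span_le.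
have step a : a \in span (g :: s) -> exists t c, [/\ t \notin p, c \in p &
    t * a - c * g \in ideal_add (ideal_mul p (span s)) L].
  move=> /sL/in_ideal_sat[t tp /in_ideal_add[y /in_mul_span_cons[c cp yc] ty]].
  exists t, c; split=> //; apply/in_ideal_add; exists (y - c * g) => //.
  by have -> : t * a - c * g - (y - c * g) = t * a - y by ring.
have [t [c [tp cp gL]]] := step g (span_in (mem_head g s)).
have up : t - c \notin p.
  by apply/negP => tcp; move/negP: tp; apply; rewrite -(subrK c t) rpredD.
have sub_s : {subset span s <= span (g :: s)}.
  by apply: span_le => x xs; apply: span_in; rewrite in_cons xs orbT.
have sL' : {subset span s <= ideal_sat p L}.
  apply: IH => a /sub_s/step[t' [c' [tp' cp' aL]]]; apply/in_ideal_sat.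
  exists ((t - c) * t'); first exact: prime_idealM.
  (* The relations of [a] and of [g] are combined to eliminate [g], which leaves a relation over [s]
     alone. *)
  have -> : (t - c) * t' * a = (t - c) * (t' * a - c' * g) + c' * (t * g - c * g) by ring.
  by apply: rpredD; apply: ideal_mull.
apply: span_le => x; rewrite in_cons => /orP[/eqP->|/span_in/sL'//].
apply: (ideal_sat_sat up); rewrite mulrBl.
move: gL => /in_ideal_add[y /ideal_mul_subr/sL' yL gL].
by rewrite -(subrK y (_ - _)) rpredD // ideal_sat_sub.
Qed.

Lemma nakayama p M L :
  {subset M <= ideal_sat p (ideal_add (ideal_mul p M) L)} ->
  {subset M <= ideal_sat p L}.
Proof.
have [s sM] := nR M => ML x; rewrite sM; move: x; apply: nakayama_span => x.
rewrite -sM => /ML; apply: ideal_sat_mono => y /in_ideal_add[z zM yz].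
apply/in_ideal_add; exists z => //.
by apply: ideal_mul_mono zM => // u; rewrite sM.
Qed.

(** Any y outside L in the last power of p not contained in L will do, since p y lies in the next
    power. *)
Lemma exists_socle p L N : 1 \notin L -> {subset ideal_pow p N <= L} ->
  exists2 y, y \notin L & forall a, a \in p -> a * y \in L.
Proof.
move=> L1; elim: N => [|N IH] NL.
  by move/negP: L1; case; apply/NL/ideal_pow0.
have [NL'|] := pselect {subset ideal_pow p N <= L}; first exact: IH.
move=> /existsNP[y /not_implyP[yN /negP yL]]; exists y => // a ap.
by apply: NL; rewrite ideal_powS ideal_mul_in.
Qed.

(* Take L maximal such that this fails, and y outside L with p y in L: either y
   lies in every J n, or, J n being saturated, J n meets L + (y) in L from some
   point on, so that J n can be compared with J n + L + (y). *)
Lemma sat_dcc p L N (J : nat -> ideal R) : {subset ideal_pow p N <= L} ->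
  (forall n, {subset J n.+1 <= J n}) ->
  (forall n t a, t \notin p -> t * a \in J n -> a \in J n) ->
  (forall n, {subset L <= J n}) -> exists n, {subset J n <= J n.+1}.
Proof.
move=> NL Jdec Jsat LJ; apply: contrapT => Jbad.
pose bad L' := {subset L <= L'} /\ exists J : nat -> ideal R,
  [/\ forall n, {subset J n.+1 <= J n},
      forall n t a, t \notin p -> t * a \in J n -> a \in J n,
      forall n, {subset L' <= J n} & ~ exists n, {subset J n <= J n.+1}].
have [|M [[LM [{LJ Jbad} {}J [{}Jdec {}Jsat MJ Jbad]]] Mmax]] :=
    @noetherian_max _ bad nR.
  by exists L; split=> //; exists J.
have Msat t a : t \notin p -> t * a \in M -> a \in M.
  move=> tp taM; apply: (Mmax (ideal_sat p M)); last 1 first.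
  - by apply/in_ideal_sat; exists t.
  - split; first by move=> x /LM; apply: ideal_sat_sub.
    exists J; split=> // n x /in_ideal_sat[u up uxM]; apply: Jsat up _.
    exact: MJ.
  - exact: ideal_sat_sub.
have M1 : 1 \notin M.
  apply/negP => M1; apply: Jbad; exists 0%N => x _; rewrite -[x]mulr1.
  exact/ideal_mull/MJ.
have [|y yM py] := @exists_socle p M N M1; first by move=> x /NL/LM.
have good (J' : nat -> ideal R) : (forall n, {subset J' n.+1 <= J' n}) ->
    (forall n t a, t \notin p -> t * a \in J' n -> a \in J' n) ->
    (forall n, {subset ideal_add M (span [:: y]) <= J' n}) ->
    exists n, {subset J' n <= J' n.+1}.
  move=> dec' sat' MJ'; apply: contrapT => bad'; move/negP: yM; apply.
  apply: (Mmax (ideal_add M (span [:: y]))); last 1 first.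
  - by apply/ideal_addr/span_in/mem_head.
  - split; first by move=> x /LM; apply: ideal_addl.
    by exists J'.
  - exact: ideal_addl.
have [yJ|/existsNP[n1 /negP yJ]] := pselect (forall n, y \in J n).
  apply: Jbad; apply: good => // n x /in_ideal_add[m /MJ mM /in_span1[c xm]].
  by rewrite -(subrK m x) xm; apply: rpredD (mM n); apply: ideal_mull.
have yJn n : y \notin J (n + n1)%N.
  elim: n => [//|n IH]; apply/negP; rewrite addSn => /Jdec.
  exact/negP.
pose J' n := ideal_sat p (ideal_add (J (n + n1)%N) (ideal_add M (span [:: y]))).
have [|||n nJ] := good J'.
- move=> n; apply: ideal_sat_mono => x /in_ideal_add[a aJ xa].
  by apply/in_ideal_add; exists a => //; apply: Jdec.
- by move=> n t a; apply: ideal_sat_sat.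
- by move=> n x xM; apply/ideal_sat_sub/ideal_addr.
apply: Jbad; exists (n + n1)%N => a aJ.
have /nJ/in_ideal_sat[t tp /in_ideal_add[b bJ /in_ideal_add[m mM]]] : a \in J' n.
  exact/ideal_sat_sub/ideal_addl.
move=> /in_span1[c tab]; rewrite -addSn.
apply: (Jsat _ _ _ tp); rewrite -(subrK b (t * a)) -(subrK m (_ - b)) tab.
have cyJ : c * y \in J (n + n1)%N.
  rewrite -tab; apply: rpredB; last exact: MJ.
  by apply: rpredB; [exact: ideal_mull|exact: Jdec].
(* If [c] were outside [p], saturation would put [y] in [J (n + n1)]; so [c] is in [p], and [c * y]
   falls in [M]. *)
have [cp|cp] := boolP (c \in p); last first.
  by have := yJn n; rewrite (Jsat _ _ _ cp cyJ).
by apply: rpredD => //; apply: MJ; apply: rpredD => //; apply: py.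
Qed.

(* If P were minimal over Q' + (x), the chain of the (x) + Q^(n), where Q^(n) are
   the symbolic powers of Q modulo Q', would stabilize at P; by Nakayama at P,
   then at Q, a power of Q would lie in Q'. *)
Lemma krull_pit (Q' Q P : prime_ideal R) x : ideal_lt Q' Q -> ideal_lt Q P ->
  x \in P -> exists P' : prime_ideal R,
    [/\ {subset Q' <= P'}, x \in P' & ideal_lt P' P].
Proof.
move=> [Q'Q QQ'] [QP PQ] xP; apply: contrapT => noP'.
have Pmin (P' : prime_ideal R) : {subset Q' <= P'} -> x \in P' ->
    {subset P' <= P} -> {subset P <= P'}.
  move=> Q'P' xP' P'P; apply: contrapT => PP'.
  by apply: noP'; exists P'; split.
have xQ : x \notin Q by apply/negP => xQ; apply/PQ/Pmin.
pose L := ideal_sat P (ideal_add Q' (span [:: x])).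
(* [L] contains a power of P: if some a in P had no power in [L], a prime over Q' + (x) missing all
   t a^i with t outside P would lie in P without containing a, against [Pmin]. *)
have [a aP|N NL] := @ideal_pow_sub_nil P L.
  apply: contrapT => noN.
  have [||t [t1 [t1P [i ->]]]|P' [JP' TP']] := @exists_prime _
      (ideal_add Q' (span [:: x]))
      [set t | exists t1, t1 \notin P /\ exists i, t = t1 * a ^+ i] nR.
  - by exists 1; split; [exact: prime_ideal1|exists 0%N; rewrite mulr1].
  - move=> _ _ [t1 [t1P [i ->]]] [t2 [t2P [j ->]]]; exists (t1 * t2).
    by split; [exact: prime_idealM|exists (i + j)%N; rewrite exprD; ring].
  - by apply/negP => aJ; apply: noN; exists i; apply/in_ideal_sat; exists t1.
  have P'P : {subset P' <= P}.
    move=> z zP'; apply: contrapT => /negP zP.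
    have /negP : z \notin P' by apply: TP'; exists z; split=> //; exists 0%N; rewrite mulr1.
    by case.
  have /negP : a \notin P'.
    by apply: TP'; exists 1; split; [exact: prime_ideal1|exists 1%N; rewrite mul1r].
  apply.
  apply: Pmin P'P _ aP; first by move=> z zQ; apply/JP'/ideal_addl.
  by apply/JP'/ideal_addr/span_in/mem_head.
pose symb n := ideal_sat Q (ideal_add (ideal_pow Q n) Q').
have symb_dec n : {subset symb n.+1 <= symb n}.
  apply: ideal_sat_mono => y /in_ideal_add[z zQ yz]; apply/in_ideal_add.
  by exists z => //; apply: ideal_pow_leq zQ.
pose J n := ideal_sat P (ideal_add (span [:: x]) (symb n)).
have [|||n Jn] := @sat_dcc P L N J NL.
- move=> n; apply: ideal_sat_mono => y /in_ideal_add[z zx yz]; apply/in_ideal_add.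
  by exists z => //; apply: symb_dec.
- by move=> n t a; apply: ideal_sat_sat.
- move=> n; apply: ideal_sat_mono => y /in_ideal_add[z zQ' yz].
  rewrite -(subrK z y); apply: rpredD; first exact: ideal_addl.
  exact/ideal_addr/ideal_sat_sub/ideal_addr.
have symbn : {subset symb n <= symb n.+1}.
  suff symbP : {subset symb n <= ideal_sat P (symb n.+1)}.
    move=> y /symbP/in_ideal_sat[t tP]; apply: ideal_sat_sat.
    by apply/negP => /QP; apply/negP.
  apply: nakayama => a an.
  have /Jn/in_ideal_sat[t tP] : a \in J n by apply/ideal_sat_sub/ideal_addr.
  move=> /in_ideal_add[y /in_span1[b ->] tab]; apply/in_ideal_sat; exists t => //.
  apply/in_ideal_add; exists (b * x) => //; rewrite mulrC; apply: ideal_mul_in => //.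
  (* [b * x] lies in [symb n], which is saturated at [Q], and [x] is outside [Q]; so [b] lies in
     [symb n]. This is what brings the factor [x] of [P] in front of [symb n] for Nakayama. *)
  apply: (ideal_sat_sat xQ); rewrite mulrC.
  have -> : b * x = t * a - (t * a - b * x) by ring.
  by apply: rpredB; [exact: ideal_mull|exact: symb_dec].
have QQ'n : {subset ideal_pow Q n <= ideal_sat Q Q'}.
  apply: nakayama => y yQ.
  have /symbn : y \in symb n by apply/ideal_sat_sub/ideal_addl.
  apply: ideal_sat_mono => z /in_ideal_add[u uQ zu]; apply/in_ideal_add.
  by exists u => //; rewrite -ideal_powS.
apply: QQ'; apply: (@ideal_pow_prime _ _ _ n) => y /QQ'n/in_ideal_sat[t tQ tyQ'].
apply: prime_prod tyQ' _.
by apply/negP => /Q'Q; apply/negP.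
Qed.

End Noetherian.

(** * Chains of primes *)

Section PreimagePrime.
Variables (R S : comPzRingType) (f : {rmorphism R -> S}).

Definition preim_ideal (J : ideal S) : ideal R := ideal_gen [set x | f x \in J].

Lemma in_preim_ideal (J : ideal S) x : x \in preim_ideal J <-> f x \in J.
Proof.
apply: ideal_gen_id => {x} [|x y /= xJ yJ|a x /= xJ].
- by rewrite /= rmorph0 rpred0.
- by rewrite rmorphB rpredB.
- by rewrite rmorphM ideal_mull.
Qed.

Variable P : prime_ideal S.

Lemma preim_ideal1 : 1 \notin preim_ideal P.
Proof.
by apply/negP => /in_preim_ideal; rewrite rmorph1; apply/negP/prime_ideal1.
Qed.

Lemma preim_idealM u v :
  u * v \in preim_ideal P -> (u \in preim_ideal P) || (v \in preim_ideal P).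
Proof.
by move=> /in_preim_ideal; rewrite rmorphM => /prime_subproofM/orP[] H;
  apply/orP; [left|right]; apply/in_preim_ideal.
Qed.

Definition preim_prime : prime_ideal R := prime_of preim_ideal1 preim_idealM.

Lemma in_preim_prime x : x \in preim_prime <-> f x \in P.
Proof. exact: in_preim_ideal. Qed.

Definition ideal_ext (I : ideal R) : ideal S :=
  ideal_gen [set f x | x in [set x | x \in I]].

Lemma ideal_ext_in (I : ideal R) x : x \in I -> f x \in ideal_ext I.
Proof. by move=> xI; apply: ideal_gen_in; exists x. Qed.

Lemma ideal_ext_le (I : ideal R) (J : ideal S) :
  (forall x, x \in I -> f x \in J) -> {subset ideal_ext I <= J}.
Proof. by move=> IJ; apply: ideal_gen_le => _ [x xI <-]; apply: IJ. Qed.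

Lemma ideal_ext_mono (I J : ideal R) :
  {subset I <= J} -> {subset ideal_ext I <= ideal_ext J}.
Proof. by move=> IJ; apply: ideal_ext_le => x /IJ; apply: ideal_ext_in. Qed.

End PreimagePrime.

Section Chains.
Variable R : comPzRingType.
Implicit Types P Q M : prime_ideal R.

Lemma ideal_lt_le_trans (I J K : ideal R) :
  ideal_lt I J -> {subset J <= K} -> ideal_lt I K.
Proof.
by move=> [IJ JI] JK; split=> [x /IJ/JK//|KI]; apply: JI => x /JK/KI.
Qed.

Lemma ideal_le_lt_trans (I J K : ideal R) :
  {subset I <= J} -> ideal_lt J K -> ideal_lt I K.
Proof.
by move=> IJ [JK KJ]; split=> [x /IJ/JK//|KI]; apply: KJ => x /KI/IJ.
Qed.

(* P = P_0 < ... < P_n <= Q; the last inclusion need not be strict, so that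
   chains can be concatenated and their end enlarged. *)
Fixpoint prime_chain n P Q : Prop :=
  if n is n'.+1 then exists2 P' : prime_ideal R, ideal_lt P P' & prime_chain n' P' Q
  else {subset P <= Q}.

Lemma prime_chain_sub n P Q : prime_chain n P Q -> {subset P <= Q}.
Proof.
by elim: n P => [|n IH] P //= [P' [PP' _] /IH P'Q] x /PP'/P'Q.
Qed.

Lemma prime_chainl n P P' Q :
  {subset P <= P'} -> prime_chain n P' Q -> prime_chain n P Q.
Proof.
case: n => [|n] PP' /=; first by move=> P'Q x /PP'/P'Q.
by move=> [P1 P'P1 c]; exists P1 => //; apply: ideal_le_lt_trans P'P1.
Qed.

Lemma prime_chain_cat m n P Q M :
  prime_chain m P Q -> prime_chain n Q M -> prime_chain (m + n) P M.
Proof.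
elim: m P => [|m IH] P /=; first exact: prime_chainl.
by move=> [P' PP' c] /(IH _ c); exists P'.
Qed.

Lemma prime_chainr n P Q M :
  {subset Q <= M} -> prime_chain n P Q -> prime_chain n P M.
Proof. by move=> QM c; rewrite -[n]addn0; apply: (@prime_chain_cat n 0 P Q M). Qed.

Lemma flag_prime_chain n (D : flag R n) : prime_chain n (D ord0) (D ord_max).
Proof.
suff: forall k, (k <= n)%N -> prime_chain k (D (inord (n - k))) (D ord_max).
  move/(_ n (leqnn n)); rewrite subnn.
  by have -> : inord 0 = ord0 :> 'I_n.+1 by apply: val_inj; rewrite /= inordK.
elim=> [|k IH] kn.
  rewrite subn0; have -> // : inord n = ord_max :> 'I_n.+1.
  by apply: val_inj; rewrite /= inordK.
exists (D (inord (n - k))); last exact/IH/ltnW.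
have ik : (n - k.+1 < n)%N by lia.
have := flag_lt D (Ordinal ik).
have -> : widen_ord (leqnSn n) (Ordinal ik) = inord (n - k.+1).
  by apply: val_inj; rewrite /= inordK //; lia.
have -> // : lift ord0 (Ordinal ik) = inord (n - k).
by apply: val_inj; rewrite /= inordK /bump /=; lia.
Qed.

(** The last member of the chain, only weakly contained in Q, is replaced by Q. For n = 0 this
    leaves the flag (Q), so the flag need not begin at P. *)
Lemma prime_chain_flag n P Q :
  prime_chain n P Q -> exists D : flag R n, D ord_max = Q.
Proof.
move=> c; have [g [_ gn glt]] : exists g : nat -> prime_ideal R,
    [/\ {subset P <= g 0%N}, g n = Q &
        forall i, (i < n)%N -> ideal_lt (g i) (g i.+1)].
  elim: n P c => [|n IH] P /=; first by exists (fun=> Q).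
  move=> [P' PP' /IH[g [P'g gn glt]]].
  exists (fun i => if i is j.+1 then g j else P); split=> // -[|i] //= ilt.
    exact: ideal_lt_le_trans P'g.
  exact: glt.
have Dlt (i : 'I_n) : ideal_lt (g (widen_ord (leqnSn n) i)) (g (lift ord0 i)).
  exact: (glt _ (ltn_ord i)).
by exists (@Flag R n (fun i => g i) Dlt).
Qed.

(** The element x is pushed down the chain: where P < P1 < P2 and x lies in P2 but not in P1, the
    principal ideal theorem replaces P1 by a prime that contains x. *)
Lemma prime_chain_through k P M x : noetherian R -> prime_chain k.+1 P M ->
  x \in M -> exists Q, [/\ {subset P <= Q}, x \in Q & prime_chain k Q M].
Proof.
move=> nR; elim: k P => [|k IH] P.
  by move=> [P' [PP' _] P'M] xM; exists M; split=> // y /PP'/P'M.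
move=> [P1 PP1 c] xM; have [P2 [P1P2 xP2 c2]] := IH _ c xM.
have [xP1|xP1] := boolP (x \in P1); first by exists P1; split=> //; case: PP1.
have [|P' [PP' xP' P'P2]] := krull_pit nR PP1 _ xP2.
  by split=> // P2P1; move/negP: xP1; apply; apply: P2P1.
by exists P'; split=> //; exists P2.
Qed.

End Chains.

(** * Transfer of chains along a ring homomorphism *)

Section ChainTransfer.
Variables (R A : comPzRingType) (f : {rmorphism R -> A}).
Hypothesis nA : noetherian A.

Lemma prime_chain_split (p : prime_ideal R) (M : prime_ideal A) k
    (P : prime_ideal A) :
  (forall r, f r \in M <-> r \in p) -> prime_chain k P M ->
  exists i j (Q : prime_ideal A), [/\ k = (i + j)%N,
    prime_chain i (preim_prime f P) p, prime_chain j Q M &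
    forall r, r \in p -> f r \in Q].
Proof.
move=> Mp; elim: k P => [|k IH] P c.
  exists 0%N, 0%N, M; split=> // [x /in_preim_prime/c/Mp//|r /Mp//].
have [pP|/existsNP[r /not_implyP[rp /negP rP]]] :=
    pselect (forall r, r \in p -> f r \in P).
  exists 0%N, k.+1, P; split=> // x /in_preim_prime xP.
  exact/Mp/(prime_chain_sub c).
have [Q [PQ rQ cQ]] := prime_chain_through nA c ((Mp r).2 rp).
have [i [j [Q' [-> ci cj pQ']]]] := IH _ cQ.
exists i.+1, j, Q'; split=> //; exists (preim_prime f Q) => //; split.
  by move=> x /in_preim_prime/PQ/in_preim_prime.
by move=> /(_ r ((in_preim_prime _ _ _).2 rQ))/in_preim_prime; apply/negP.
Qed.

Hypothesis flat_colon : forall (J : ideal R) s a,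
  f s * a \in ideal_ext f J -> a \in ideal_ext f (ideal_colon J s).

(** Q is a prime over q A that misses all f(s) t with s outside q and t outside Q'. Such products
    avoid q A: otherwise t would lie in (q : s) A = q A, which Q' contains. *)
Lemma going_down (q q' : prime_ideal R) (Q' : prime_ideal A) :
  {subset q <= q'} -> (forall r, f r \in Q' <-> r \in q') ->
  exists Q : prime_ideal A, {subset Q <= Q'} /\ forall r, f r \in Q <-> r \in q.
Proof.
move=> qq' Qq'; have [||x [s [t [sq tQ ->]]]|Q [qQ TQ]] := @exists_prime _ (ideal_ext f q)
    [set x | exists s t, [/\ s \notin q, t \notin Q' & x = f s * t]] nA.
- by exists 1, 1; rewrite !prime_ideal1 rmorph1 mulr1.
- move=> _ _ [s [t [sq tQ ->]]] [s' [t' [sq' tQ' ->]]]; exists (s * s'), (t * t').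
  by split; [exact: prime_idealM|exact: prime_idealM|rewrite rmorphM mulrACA].
- apply/negP => /flat_colon st; move/negP: tQ; apply; move: t st.
  by apply: ideal_ext_le => r /in_ideal_colon/prime_prod/(_ sq)/qq'/Qq'.
exists Q; split=> [x xQ|r].
  apply: contrapT => /negP xQ'; have : x \notin Q.
    by apply: TQ; exists 1, x; rewrite prime_ideal1 rmorph1 mul1r.
  by rewrite xQ.
split=> [rQ|rq]; last exact/qQ/ideal_ext_in.
apply: contrapT => /negP rq; have : f r \notin Q.
  by apply: TQ; exists r, 1; rewrite prime_ideal1 mulr1.
by rewrite rQ.
Qed.

Lemma prime_chain_lift n (q p : prime_ideal R) (P : prime_ideal A) :
  (forall r, f r \in P <-> r \in p) -> prime_chain n q p ->
  exists2 Q : prime_ideal A, (forall r, f r \in Q <-> r \in q) & prime_chain n Q P.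
Proof.
move=> Pp; elim: n q => [|n IH] q /=.
  by move=> qp; have [Q [QP Qq]] := going_down qp Pp; exists Q.
move=> [q' [qq' q'q] /IH[Q' Qq' c]]; have [Q [QQ' Qq]] := going_down qq' Qq'.
exists Q => //; exists Q' => //; split=> // Q'Q.
by apply: q'q => r /Qq'/Q'Q/Qq.
Qed.

End ChainTransfer.

(** * Extended ideals and localization *)

Section Extension.
Variables (R A : comPzRingType) (f : {rmorphism R -> A}).
Implicit Types I J K : ideal R.

Lemma in_ideal_ext_add J K x : x \in ideal_ext f (ideal_add J K) ->
  exists2 y, y \in ideal_ext f J & x - y \in ideal_ext f K.
Proof.
move=> xJK; apply/in_ideal_add; move: x xJK.
apply: ideal_ext_le => r /in_ideal_add[j jJ rjK]; apply/in_ideal_add.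
by exists (f j); [exact: ideal_ext_in|rewrite -rmorphB ideal_ext_in].
Qed.

(** The coefficients are kept in I A: with I a power of p, they can be summed to convergent series
    or absorbed in a small correction. *)
Lemma in_ideal_ext_mul I s x : x \in ideal_ext f (ideal_mul I (span s)) ->
  exists u : nat -> A, (forall i, u i \in ideal_ext f I) /\
    x = \sum_(i < size s) f s`_i * u i.
Proof.
move=> xI; apply/(@ideal_gen_id _ [set x | exists u : nat -> A,
    (forall i, u i \in ideal_ext f I) /\ x = \sum_(i < size s) f s`_i * u i]).
- exists (fun=> 0); split=> [_|]; first exact: rpred0.
  by rewrite big1 // => i _; rewrite mulr0.
- move=> _ _ [u [uI ->]] [v [vI ->]]; exists (fun i => u i - v i).
  split=> [i|]; first exact: rpredB.
  by rewrite -sumrB; apply: eq_bigr => i _; rewrite mulrBr.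
- move=> a _ [u [uI ->]]; exists (fun i => a * u i).
  split=> [i|]; first exact: ideal_mull.
  by rewrite mulr_sumr; apply: eq_bigr => i _; rewrite mulrCA.
move: x xI; apply: ideal_ext_le => x xI; apply/in_preim_ideal; move: x xI.
apply: ideal_mul_le => i y iI /in_span[c ->]; apply/in_preim_ideal/ideal_gen_in.
exists (fun k => f (i * c k)); split=> [k|].
  by apply: ideal_ext_in; apply: ideal_mulr.
rewrite mulr_sumr rmorph_sum; apply: eq_bigr => k _.
by rewrite mulrA rmorphM mulrC.
Qed.

End Extension.

Section Flatness.
Variable R : comPzRingType.
Implicit Types (J K : ideal R) (A : algebra R).

(* Both hold for a flat R-algebra: the first lets Artin-Rees be applied in R to
   ideals extended to A, the second gives going down. *)
Definition ideal_flat A : Prop :=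
  (forall J K a, a \in ideal_ext (@alg_map R A) J ->
    a \in ideal_ext (@alg_map R A) K ->
    a \in ideal_ext (@alg_map R A) (ideal_cap J K)) /\
  (forall J s a, alg_map A s * a \in ideal_ext (@alg_map R A) J ->
    a \in ideal_ext (@alg_map R A) (ideal_colon J s)).

Lemma base_flat : ideal_flat (base_algebra R).
Proof.
have extE J a : a \in ideal_ext (@alg_map R (base_algebra R)) J -> a \in J.
  by apply: ideal_ext_le.
have inE J a : a \in J -> a \in ideal_ext (@alg_map R (base_algebra R)) J.
  exact: (@ideal_ext_in _ _ (@alg_map R (base_algebra R))).
split=> [J K a /extE aJ /extE aK|J s a /extE sa]; apply: inE.
  exact/in_ideal_cap.
exact/in_ideal_colon.
Qed.

End Flatness.

Section LocalizationTheory.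
Variables (R : comPzRingType) (p : prime_ideal R) (A : algebra R).
Local Notation f := (@alg_map R A).
Local Notation L := (loc_algebra p A).
Implicit Types J : ideal R.

Lemma loc_fracM (a b : A) (s t : {s : R | s \notin p}) :
  loc_frac a s * loc_frac b t = loc_frac (a * b) (frac_denM s t).
Proof. exact: loc_mulE. Qed.

Lemma loc_fracB (a b : A) (s t : {s : R | s \notin p}) :
  loc_frac a s - loc_frac b t =
  loc_frac (f (\val t) * a - f (\val s) * b) (frac_denM s t).
Proof.
rewrite -[LHS]/(loc_add _ (loc_opp _)) loc_oppE loc_addE.
by apply: loc_eq1; rewrite mulrN.
Qed.

Definition loc_in (a : A) : localization p A := loc_frac a (frac_den1 p).

Lemma loc_in_zmod_morphism : zmod_morphism loc_in.
Proof.
move=> x y; rewrite /loc_in loc_fracB; apply: loc_eq1.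
by rewrite /= !rmorphM !rmorph1; ring.
Qed.
HB.instance Definition _ :=
  GRing.isZmodMorphism.Build A (localization p A) loc_in loc_in_zmod_morphism.

Lemma loc_in_monoid_morphism : monoid_morphism loc_in.
Proof.
split=> // x y; rewrite /loc_in loc_fracM.
by apply: loc_eq1; rewrite /= !rmorphM rmorph1; ring.
Qed.
HB.instance Definition _ :=
  GRing.isMonoidMorphism.Build A (localization p A) loc_in loc_in_monoid_morphism.

Lemma loc_frac_in a s : loc_frac a s = loc_frac 1 s * loc_in a.
Proof.
by rewrite loc_fracM; apply: loc_eq1; rewrite /= !rmorphM rmorph1; ring.
Qed.

Lemma loc_in_frac a s : loc_in a = loc_in (f (\val s)) * loc_frac a s.
Proof.
by rewrite loc_fracM; apply: loc_eq1; rewrite /= !rmorphM rmorph1; ring.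
Qed.

Lemma alg_map_locE r : alg_map L r = loc_in (f r).
Proof. by []. Qed.

Lemma loc_in_ext J a :
  a \in ideal_ext f J -> loc_in a \in ideal_ext (@alg_map R L) J.
Proof.
move=> aJ; apply/in_preim_ideal; move: a aJ; apply: ideal_ext_le => r rJ.
by apply/in_preim_ideal; apply: (@ideal_ext_in _ _ (@alg_map R L)).
Qed.

Lemma in_loc_ext J a s : loc_frac a s \in ideal_ext (@alg_map R L) J <->
  exists2 u, u \notin p & f u * a \in ideal_ext f J.
Proof.
split=> [xJ|[u up ua]]; last first.
  rewrite loc_frac_in; apply: ideal_mull.
  have -> : loc_in a = loc_frac 1 (Sub u up) * loc_in (f u * a).
    by rewrite loc_fracM; apply: loc_eq1; rewrite /= !rmorphM rmorph1; ring.
  exact/ideal_mull/loc_in_ext.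
(* The ideal closure is checked for fractions having some good representative; the given
   representative [a], [s] is treated afterwards. *)
have : exists b t u, [/\ loc_frac a s = loc_frac b t, u \notin p &
    f u * b \in ideal_ext f J].
  apply/(@ideal_gen_id _ [set x | exists b (t : {s : R | s \notin p}) u,
      [/\ x = loc_frac b t, u \notin p & f u * b \in ideal_ext f J]]).
  - by exists 0, (frac_den1 p), 1; rewrite prime_ideal1 mulr0 rpred0.
  - move=> _ _ [b [t [u [-> up ub]]]] [c [r [v [-> vp vc]]]].
    exists (f (\val r) * b - f (\val t) * c), (frac_denM t r), (u * v).
    split; [exact: loc_fracB|exact: prime_idealM|rewrite rmorphM].
    have -> : f u * f v * (f (\val r) * b - f (\val t) * c) =
      f v * f (\val r) * (f u * b) - f u * f (\val t) * (f v * c) by ring.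
    by apply: rpredB; apply: ideal_mull.
  - elim/loc_ind=> c r _ [b [t [u [-> up ub]]]].
    exists (c * b), (frac_denM r t), u; split; rewrite ?loc_fracM //.
    by rewrite mulrCA ideal_mull.
  move: xJ; apply: ideal_ext_le => r rJ; apply: ideal_gen_in.
  exists (f r), (frac_den1 p), 1; rewrite prime_ideal1 rmorph1 mul1r.
  by split=> //; apply: ideal_ext_in.
move=> [b [t [u [/loc_fracP[w wp e] up ub]]]]; exists (w * \val t * u).
  by rewrite !prime_idealM // (valP t).
have -> : f (w * \val t * u) * a =
    f w * f (\val s) * (f u * b) + f u * (f w * (f (\val t) * a - f (\val s) * b)).
  by rewrite !rmorphM; ring.
by rewrite e mulr0 addr0; apply: ideal_mull.
Qed.

Lemma loc_flat : ideal_flat A -> ideal_flat L.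
Proof.
move=> [capA colonA]; split=> [J K|J s]; elim/loc_ind=> a t.
  move=> /in_loc_ext[u up ua] /in_loc_ext[v vp va]; apply/in_loc_ext.
  exists (u * v); first exact: prime_idealM.
  by apply: capA; rewrite rmorphM -mulrA; [rewrite mulrCA|]; apply: ideal_mull.
rewrite loc_fracM => /in_loc_ext[u up sua]; apply/in_loc_ext.
by exists u => //; apply: colonA; rewrite mulrCA.
Qed.

Lemma loc_noetherian : noetherian A -> noetherian L.
Proof.
move=> nA J; have [s sJ] := nA (preim_ideal loc_in J).
exists (map loc_in s) => x; apply/idP/idP; move: x; last first.
  apply: span_le => _ /mapP[a /(@span_in _ s) as_ ->].
  by apply/in_preim_ideal; rewrite sJ.
elim/loc_ind=> a t xJ; rewrite loc_frac_in; apply: ideal_mull.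
have {xJ} : a \in preim_ideal loc_in J.
  apply/in_preim_ideal; have := ideal_mull (loc_in (f (\val t))) xJ.
  by rewrite -loc_in_frac.
rewrite sJ => as_; apply/in_preim_ideal; move: a as_; apply: span_le => a as_.
exact/in_preim_ideal/span_in/map_f.
Qed.

Lemma loc_unit r : r \notin p -> exists y : L, alg_map L r * y = 1.
Proof.
move=> rp; exists (loc_frac 1 (Sub r rp)).
rewrite alg_map_locE loc_fracM; apply: loc_eq1.
by rewrite /= !rmorphM rmorph1; ring.
Qed.

End LocalizationTheory.

(** * Completion *)

Section CompletionTheory.
Variables (R : comPzRingType) (p : ideal R) (A : algebra R).
Local Notation f := (@alg_map R A).
Local Notation T := (completion_algebra p A).
Local Notation fT := (@alg_map R T).
Implicit Types (J K : ideal R) (x y : completion p A).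

Lemma completion_valB x y l :
  completion_val (x - y) l = completion_val x l - completion_val y l.
Proof. by have -> : completion_val (x - y) = _ := rmorphB val x y. Qed.

Lemma completion_valM x y l :
  completion_val (x * y) l = completion_val x l * completion_val y l.
Proof. by have -> : completion_val (x * y) = _ := rmorphM val x y. Qed.

Lemma completion_val0 l : completion_val (0 : completion p A) l = 0.
Proof. by have -> : completion_val 0 = 0 := rmorph0 (val : completion p A -> _). Qed.

(** The kernel of the projection of the completion T onto A / p^l A, a priori larger than p^l T. *)
Definition filt l : ideal (completion p A) :=
  ideal_gen [set x | completion_val x l = 0].

Lemma in_filt l x : x \in filt l <-> completion_val x l = 0.
Proof.
apply: ideal_gen_id => {x} [|x y /= xl yl|a x /= xl].
- exact: completion_val0.
- by have := completion_valB x y l; rewrite xl yl subrr.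
- by have := completion_valM a x l; rewrite xl mulr0.
Qed.

Lemma completion_in_subproof (a : A) :
  ((fun l => quot_pi (ext_pow p A l) a) : dprod _) \in @compatible R p A.
Proof. by apply/asboolP => l; rewrite trans_piE. Qed.

Definition completion_in (a : A) : completion p A :=
  Completion (completion_in_subproof a).

Lemma completion_in_zmod_morphism : zmod_morphism completion_in.
Proof.
move=> x y; apply: val_inj; rewrite rmorphB /=.
by apply: functional_extensionality_dep => l; rewrite !rmorphB.
Qed.
HB.instance Definition _ := GRing.isZmodMorphism.Build A (completion p A)
  completion_in completion_in_zmod_morphism.

Lemma completion_in_monoid_morphism : monoid_morphism completion_in.
Proof.
split=> [|x y]; apply: val_inj; rewrite ?rmorph1 ?rmorphM /=;
  by apply: functional_extensionality_dep => l; rewrite ?rmorph1 ?rmorphM.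
Qed.
HB.instance Definition _ := GRing.isMonoidMorphism.Build A (completion p A)
  completion_in completion_in_monoid_morphism.

Lemma alg_map_completionE r : fT r = completion_in (f r).
Proof. exact: val_inj. Qed.

Lemma completion_in_ext J a :
  a \in ideal_ext f J -> completion_in a \in ideal_ext fT J.
Proof.
move=> aJ; apply/in_preim_ideal; move: a aJ; apply: ideal_ext_le => r rJ.
apply/in_preim_ideal; have := ideal_ext_in fT rJ.
by rewrite alg_map_completionE.
Qed.

Lemma filt_in l a : completion_in a \in filt l <-> a \in ideal_ext f (ideal_pow p l).
Proof.
rewrite -[ideal_ext _ _]/(ext_pow p A l); split=> [/in_filt/= H|al].
  by have := quot_piE (ext_pow p A l) a 0; rewrite subr0 => <-; rewrite rmorph0; apply/eqP.
apply/in_filt => /=; apply/eqP.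
by rewrite -(rmorph0 (quot_pi (ext_pow p A l))) quot_piE subr0.
Qed.

Lemma filt_ex l x : exists a, x - completion_in a \in filt l.
Proof.
exists (repr (completion_val x l)); apply/in_filt.
by rewrite completion_valB /= quot_reprK subrr.
Qed.

Lemma filt_sep x : (forall l, x \in filt l) -> x = 0.
Proof.
move=> x0; apply: val_inj; apply: functional_extensionality_dep => l.
have /in_filt xl := x0 l; rewrite [LHS]xl.
by rewrite [RHS]completion_val0.
Qed.

Lemma filtS l : {subset filt l.+1 <= filt l}.
Proof.
move=> x /in_filt xl; apply/in_filt.
have /asboolP <- : completion_val x \in @compatible R p A by case: x {xl}.
rewrite xl -(rmorph0 (quot_pi (ext_pow p A l.+1))) trans_piE.
exact: rmorph0.
Qed.

Lemma filt_leq l m : (l <= m)%N -> {subset filt m <= filt l}.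
Proof.
by move=> /subnKC <-; elim: (m - l)%N => [|k IH] x; rewrite ?addn0 ?addnS // => /filtS/IH.
Qed.

Lemma filt0 x : x \in filt 0.
Proof.
have [a xa] := filt_ex 0 x; rewrite -(subrK (completion_in a) x) rpredD //.
apply/filt_in; rewrite -[a]mulr1 -(rmorph1 f); apply: ideal_mull.
exact/ideal_ext_in/ideal_pow0.
Qed.

Lemma ext_filt l : {subset ideal_ext fT (ideal_pow p l) <= filt l}.
Proof.
apply: ideal_ext_le => r rl; rewrite alg_map_completionE.
exact/filt_in/ideal_ext_in.
Qed.

(** Completeness: the limit is the diagonal element, whose component at level l is that of [z l]. *)
Lemma filt_lim (z : nat -> completion p A) :
  (forall l, z l.+1 - z l \in filt l) -> exists y, forall l, y - z l \in filt l.
Proof.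
move=> zC.
have yP : ((fun l => completion_val (z l) l) : dprod _) \in @compatible R p A.
  apply/asboolP => l; have /asboolP -> : completion_val (z l.+1) \in @compatible R p A.
    by case: (z l.+1).
  have /in_filt/eqP := zC l; rewrite completion_valB subr_eq0 => /eqP.
  by [].
exists (Completion yP) => l; apply/in_filt.
by rewrite completion_valB subrr.
Qed.

Lemma filt_sub_ext l m x a b : (l <= m)%N -> x - completion_in a \in filt l ->
  x - completion_in b \in filt m -> a - b \in ideal_ext f (ideal_pow p l).
Proof.
move=> lm xa xb; apply/filt_in; rewrite rmorphB.
have -> : completion_in a - completion_in b =
  (x - completion_in b) - (x - completion_in a) by ring.
by apply: rpredB => //; apply: filt_leq xb.
Qed.

(* A limit of elements of KA lies in KT provided that the p-adic topology of
   the ideal KA is induced by the one of A. *)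
Lemma filt_closed K x : fin_gen K ->
  (forall l, exists m, forall a, a \in ideal_ext f K ->
    a \in ideal_ext f (ideal_pow p m) ->
    a \in ideal_ext f (ideal_mul (ideal_pow p l) K)) ->
  (forall l, exists2 a, a \in ideal_ext f K & x - completion_in a \in filt l) ->
  x \in ideal_ext fT K.
Proof.
move=> [s sK] AR xK.
have [m mP] := choice AR.
(* [M] is nondecreasing and bounds both [m l] and [l], so approximations of x modulo [filt (M l)]
   converge to x and successive ones differ by an element of p^l K A. *)
pose fix M l := if l is l'.+1 then maxn (M l') (maxn (m l) l) else maxn (m 0%N) 0.
have Mm l : (m l <= M l)%N by case: l => [|l] /=; lia.
have Ml l : (l <= M l)%N by case: l => [|l] /=; lia.
have MS l : (M l <= M l.+1)%N by rewrite /=; lia.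
have {xK} xk l : exists a, a \in ideal_ext f K /\ x - completion_in a \in filt (M l).
  by have [a] := xK (M l); exists a.
have [k kP] := choice xk.
have {mP} ku l : exists u : nat -> A, (forall i, u i \in ideal_ext f (ideal_pow p l)) /\
    k l.+1 - k l = \sum_(i < size s) f s`_i * u i.
  apply: in_ideal_ext_mul; apply: (@ideal_ext_mono _ _ _ (ideal_mul (ideal_pow p l) K)).
    by apply: ideal_mul_mono => // y; rewrite sK.
  apply: mP; first by apply: rpredB; case: (kP l) (kP l.+1) => ? _ [].
  rewrite -opprB rpredN; apply: filt_sub_ext (kP l.+1).2; last first.
    by have [_] := kP l; apply: filt_leq.
  exact: leq_trans (Mm l) (MS l).
have [u uP] := choice ku.
(* As [u j i] lies in p^j A, the i-th coefficients form a convergent series in T. *)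
have yex i : exists y, forall l, y - completion_in (\sum_(j < l) u j i) \in filt l.
  apply: filt_lim => l; rewrite big_ord_recr -rmorphB /= addrAC subrr add0r.
  by apply/filt_in; case: (uP l).
have [y yP] := choice yex.
have -> : x = completion_in (k 0%N) + \sum_(i < size s) fT s`_i * y i.
  apply/eqP; rewrite -subr_eq0; apply/eqP/filt_sep => l.
  have kl : k l = k 0%N + \sum_(i < size s) f s`_i * \sum_(j < l) u j i.
    elim: l => [|l IH].
      by rewrite big1 ?addr0 // => i _; rewrite big_ord0 mulr0.
    rewrite -(subrK (k l) (k l.+1)) (uP l).2 [in LHS]IH addrCA -big_split.
    by congr (_ + _); apply: eq_bigr => i _; rewrite big_ord_recr mulrDr addrC.
  have -> : x - (completion_in (k 0%N) + \sum_(i < size s) fT s`_i * y i) =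
      (x - completion_in (k l)) -
      \sum_(i < size s) fT s`_i * (y i - completion_in (\sum_(j < l) u j i)).
    have -> : completion_in (k l) = completion_in (k 0%N) +
        \sum_(i < size s) fT s`_i * completion_in (\sum_(j < l) u j i).
      rewrite kl rmorphD rmorph_sum; congr (_ + _); apply: eq_bigr => i _.
      by rewrite rmorphM alg_map_completionE.
    have -> : \sum_(i < size s) fT s`_i * (y i - completion_in (\sum_(j < l) u j i)) =
        \sum_(i < size s) fT s`_i * y i -
        \sum_(i < size s) fT s`_i * completion_in (\sum_(j < l) u j i).
      by rewrite -sumrB; apply: eq_bigr => i _; rewrite mulrBr.
    by ring.
  apply: rpredB; last by apply: rpred_sum => i _; apply/ideal_mull/yP.
  by apply: filt_leq (kP l).2.
apply: rpredD; first by apply: completion_in_ext; case: (kP 0%N).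
apply: rpred_sum => i _; apply/ideal_mulr/ideal_ext_in.
by rewrite sK; apply/span_in/mem_nth.
Qed.

(** * Flatness of the completion *)

Section Flat.
Hypotheses (nR : noetherian R) (flatA : ideal_flat A).

(** By flatness, K A and p^m A meet in the extension of the intersection of K and p^m, to which
    Artin-Rees in R applies. *)
Lemma ext_artin_rees K l : exists m, forall a, a \in ideal_ext f K ->
  a \in ideal_ext f (ideal_pow p m) ->
  a \in ideal_ext f (ideal_mul (ideal_pow p l) K).
Proof.
have [m mP] := artin_rees nR p K l; exists m => a aK am.
apply: ideal_ext_mono (flatA.1 _ _ _ aK am) => r /in_ideal_cap[].
exact: mP.
Qed.

Lemma completion_closed K x :
  (forall l, exists2 a, a \in ideal_ext f K & x - completion_in a \in filt l) ->
  x \in ideal_ext fT K.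
Proof. by apply: filt_closed; [exact: nR|exact: ext_artin_rees]. Qed.

Lemma in_completion_ext K x l a : x \in ideal_ext fT K -> x - completion_in a \in filt l ->
  a \in ideal_add (ideal_ext f K) (ideal_ext f (ideal_pow p l)).
Proof.
move=> xK xa; suff [b bK xb] : exists2 b, b \in ideal_ext f K & x - completion_in b \in filt l.
  by apply/in_ideal_add; exists b => //; apply: filt_sub_ext xb.
apply/(@ideal_gen_id _ [set x | exists2 b, b \in ideal_ext f K & x - completion_in b \in filt l]).
- by exists 0; rewrite ?rpred0 // rmorph0 subr0 rpred0.
- move=> {xK xa} {}x y [b bK xb] [c cK yc]; exists (b - c); first exact: rpredB.
  rewrite rmorphB.
  have -> : x - y - (completion_in b - completion_in c) =
    (x - completion_in b) - (y - completion_in c) by ring.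
  exact: rpredB.
- move=> z {xK xa} {}x [b bK xb]; have [c zc] := filt_ex l z.
  exists (c * b); first exact: ideal_mull.
  have -> : z * x - completion_in (c * b) =
    z * (x - completion_in b) + completion_in b * (z - completion_in c).
    by rewrite rmorphM; ring.
  by apply: rpredD; apply: ideal_mull.
move: x xK {xa}; apply: ideal_ext_le => r rK; apply: ideal_gen_in.
by exists (f r); [exact: ideal_ext_in|rewrite alg_map_completionE subrr rpred0].
Qed.

(** An approximation of x is close to some b in J A and some c in K A, so b - c lies in p^l (J + K)
    A by Artin-Rees. Splitting it as d in p^l J A plus a part in p^l K A gives b - d in both J A and
    K A, still close to x; closedness concludes. *)
Lemma completion_flat : ideal_flat T.
Proof.
split=> [J K x xJ xK|J s x sx]; apply: completion_closed => l.
  have [m mP] := ext_artin_rees (ideal_add J K) l.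
  have [a xa] := filt_ex (maxn l m) x.
  have /in_ideal_add[b bJ ab] := in_completion_ext xJ xa.
  have /in_ideal_add[c cK ac] := in_completion_ext xK xa.
  have powm (k : nat) : (k <= maxn l m)%N ->
      {subset ideal_ext f (ideal_pow p (maxn l m)) <= ideal_ext f (ideal_pow p k)}.
    by move=> km; apply: ideal_ext_mono; apply: ideal_pow_leq.
  have bJK : b - c \in ideal_ext f (ideal_mul (ideal_pow p l) (ideal_add J K)).
    apply: mP.
      apply: rpredB.
        by apply: ideal_ext_mono bJ; apply: ideal_addl.
      by apply: ideal_ext_mono cK; apply: ideal_addr.
    have -> : b - c = (a - c) - (a - b) by ring.
    by apply: rpredB; apply: (powm m) => //; lia.
  have {bJK} : b - c \in ideal_ext f (ideal_add (ideal_mul (ideal_pow p l) J)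
                                               (ideal_mul (ideal_pow p l) K)).
    apply: ideal_ext_mono bJK; apply: ideal_mul_le => i y il /in_ideal_add[j jJ yj].
    apply/in_ideal_add; exists (i * j); first exact: ideal_mul_in.
    by rewrite -mulrBr; apply: ideal_mul_in.
  move=> /in_ideal_ext_add[d dJ bcd]; exists (b - d).
    apply: flatA.1.
      by apply: rpredB => //; apply: ideal_ext_mono dJ; apply: ideal_mul_subr.
    have -> : b - d = c + (b - c - d) by ring.
    by apply: rpredD => //; apply: ideal_ext_mono bcd; apply: ideal_mul_subr.
  have -> : x - completion_in (b - d) =
      (x - completion_in a) + completion_in (a - b + d) by rewrite rmorphB rmorphD rmorphB; ring.
  apply: rpredD; first by apply: filt_leq xa; lia.
  apply/filt_in; apply: rpredD; first by apply: (powm l) => //; lia.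
  by apply: ideal_ext_mono dJ; apply: ideal_mul_subl.
(* The same correction for colons, with (s) in place of K: s a - b = c + s u with u in p^l A, so s
   (a - u) lies in J A and a - u still approximates x. *)
have [m mP] := ext_artin_rees (ideal_add J (span [:: s])) l.
have [a xa] := filt_ex (maxn l m) x.
have sxa : fT s * x - completion_in (f s * a) \in filt (maxn l m).
  by rewrite alg_map_completionE rmorphM -mulrBr ideal_mull.
have /in_ideal_add[b bJ sab] := in_completion_ext sx sxa.
have : f s * a - b \in ideal_ext f (ideal_add (ideal_mul (ideal_pow p l) J)
    (ideal_mul (ideal_pow p l) (span [:: s]))).
  have : f s * a - b \in ideal_ext f (ideal_mul (ideal_pow p l) (ideal_add J (span [:: s]))).
    apply: mP.
      apply: rpredB; last by apply: ideal_ext_mono bJ; apply: ideal_addl.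
      apply/ideal_mulr/ideal_ext_in/ideal_addr/span_in/mem_head.
    by apply: ideal_ext_mono sab; apply: ideal_pow_leq; lia.
  apply: ideal_ext_mono; apply: ideal_mul_le => i y il /in_ideal_add[j jJ yj].
  apply/in_ideal_add; exists (i * j); first exact: ideal_mul_in.
  by rewrite -mulrBr; apply: ideal_mul_in.
move=> /in_ideal_ext_add[c cJ /in_ideal_ext_mul[u [ul]]].
rewrite big_ord_recl big_ord0 addr0 /= => e.
exists (a - u 0%N).
  apply: flatA.2; have -> : f s * (a - u 0%N) = b + c.
    by rewrite mulrBr -e; ring.
  by apply: rpredD => //; apply: ideal_ext_mono cJ; apply: ideal_mul_subr.
rewrite rmorphB opprB addrA addrAC; apply: rpredD; last exact/filt_in.
by apply: filt_leq xa; lia.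
Qed.

End Flat.

End CompletionTheory.

(** * Noetherianity of the completion *)

Lemma ideal_ext_mulM (R A : comPzRingType) (f : {rmorphism R -> A}) (J K : ideal R) x y :
  x \in ideal_ext f J -> y \in ideal_ext f K -> x * y \in ideal_ext f (ideal_mul J K).
Proof.
move=> xJ yK; apply/in_ideal_colon; move: y yK; apply: ideal_ext_le => k kK.
apply/in_ideal_colon; rewrite mulrC; apply/in_ideal_colon; move: x xJ.
apply: ideal_ext_le => j jJ; apply/in_ideal_colon.
by rewrite -rmorphM mulrC; apply/ideal_ext_in/ideal_mul_in.
Qed.

Lemma ideal_ext_exp (R A : comPzRingType) (f : {rmorphism R -> A}) (J : ideal R) x l :
  x \in ideal_ext f J -> x ^+ l \in ideal_ext f (ideal_pow J l).
Proof.
move=> xJ; elim: l => [|l IH].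
  by rewrite expr0 -(rmorph1 f); apply/ideal_ext_in/ideal_pow0.
rewrite exprS; apply: ideal_ext_mono (ideal_ext_mulM xJ IH) => y.
by rewrite ideal_powS.
Qed.

Section CompletionNoetherian.
Variables (R : comPzRingType) (p : ideal R) (A : algebra R).
Local Notation f := (@alg_map R A).
Local Notation T := (completion_algebra p A).
Local Notation fT := (@alg_map R T).
Implicit Types x y z : completion p A.

Lemma completion_unit z : z \in ideal_ext fT p -> exists y, (1 - z) * y = 1.
Proof.
move=> zp; have zl l : z ^+ l \in filt p A l by apply/ext_filt/ideal_ext_exp.
have [|y yP] := @filt_lim _ p A (fun l => \sum_(j < l) z ^+ j).
  by move=> l; rewrite big_ord_recr /= addrAC subrr add0r.
exists y; apply/eqP; rewrite -subr_eq0; apply/eqP/filt_sep => l.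
have -> : (1 - z) * y - 1 = (1 - z) * (y - \sum_(j < l) z ^+ j) - z ^+ l.
  have -> : z ^+ l = (z - 1) * (\sum_(j < l) z ^+ j) + 1 by rewrite -subrX1 subrK.
  by ring.
by apply: rpredB => //; apply: ideal_mull.
Qed.

(** For K = p the hypothesis of [filt_closed] on topologies is immediate, since p^(l+1) = p^l p. *)
Lemma filt1_ext x : fin_gen p -> x \in filt p A 1 -> x \in ideal_ext fT p.
Proof.
move=> fp x1; apply: filt_closed => // l.
  exists l.+1 => a _; apply: ideal_ext_mono => r; rewrite ideal_powS.
  by apply: ideal_mul_le => i j ip jl; rewrite mulrC ideal_mul_in.
case: l => [|l]; first by exists 0; rewrite ?rpred0 // filt0.
have [a xa] := filt_ex l.+1 x; exists a => //.
suff : a \in ideal_ext f (ideal_pow p 1).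
  by apply: ideal_ext_mono => r; rewrite ideal_powS; apply: ideal_mul_subl.
apply/filt_in; rewrite -(subrK x (completion_in _ _)) rpredD // -opprB rpredN.
exact: filt_leq xa.
Qed.

Section MaximalNonFinGen.
Variable J : ideal T.
Hypotheses (Jnfg : ~ fin_gen J)
  (Jmax : forall K : ideal T, ~ fin_gen K -> {subset J <= K} -> {subset K <= J}).

Lemma larger_fin_gen (K : ideal T) z :
  {subset J <= K} -> z \in K -> z \notin J -> fin_gen K.
Proof.
by move=> JK zK /negP zJ; apply: contrapT => Kfg; apply: zJ; apply: Jmax zK.
Qed.

(* J + (a) is finitely generated, and so is (J : a) if it is not J; in that
   case J is generated by elements of J that span J modulo a, and by the
   a b with b in (J : a).  If (J : a) = J, then J = span ps + a J, and iterating
   this gives J = span ps by completeness. *)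
Lemma max_non_fin_gen r : r \in p -> fT r \in J.
Proof.
move=> rp; apply: contrapT => /negP aJ; pose a := fT r.
have [||s sJ] := @larger_fin_gen (ideal_add J (span [:: a])) a _ _ aJ.
- exact: ideal_addl.
- exact/ideal_addr/span_in/mem_head.
have jex g : exists j, g \in ideal_add J (span [:: a]) -> j \in J /\ g - j \in span [:: a].
  have [/in_ideal_add[j jJ gj]|ng] := boolP (g \in ideal_add J (span [:: a])).
    by exists j.
  by exists 0.
have [j jP] := choice jex.
pose ps := map j s.
have psJ : {subset span ps <= J}.
  by apply: span_le => _ /mapP[g gs ->]; apply: (jP g _).1; rewrite sJ span_in.
have Jps x : x \in J -> exists y x', [/\ y \in span ps, x = y + a * x' & a * x' \in J].
  move=> xJ; have : x \in ideal_add (span ps) (span [:: a]).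
    have : x \in span s by rewrite -sJ ideal_addl.
    apply: span_le => g gs; apply/in_ideal_add; exists (j g).
      exact/span_in/map_f.
    by apply: (jP g _).2; rewrite sJ span_in.
  move=> /in_ideal_add[y yps /in_span1[x' e]]; exists y, x'.
  have e' : a * x' = x - y by rewrite e mulrC.
  rewrite e'; split=> //; first by rewrite addrCA subrr addr0.
  by apply: rpredB => //; apply: psJ.
have [/existsNP[b /not_implyP[/in_ideal_colon bJ /negP b'J]]|] :=
    pselect (~ {subset ideal_colon J a <= J}).
  have [||s' s'J] := @larger_fin_gen (ideal_colon J a) b _ _ b'J.
  - exact: ideal_colon_sub.
  - exact/in_ideal_colon.
  apply: Jnfg; exists (ps ++ map (fun x => a * x) s') => x; apply/idP/idP.
    move=> /Jps[y [x' [yps -> ax'J]]]; apply: rpredD; first exact: span_catl.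
    apply/in_ideal_colon.
    have : x' \in span s' by rewrite -s'J; apply/in_ideal_colon.
    move: (x'); apply: span_le => z zs'; apply/in_ideal_colon/span_catr.
    exact/span_in/map_f.
  apply: span_le => z; rewrite mem_cat => /orP[/(@span_in _ ps)/psJ//|].
  by move=> /mapP[c cs' ->]; apply/in_ideal_colon; rewrite s'J span_in.
move=> /contrapT colonJ; apply: Jnfg; exists ps => x; apply/idP/idP; last exact: psJ.
have step (z : T) : exists c : (nat -> T) * T, z \in J ->
    c.2 \in J /\ z = \sum_(i < size ps) c.1 i * ps`_i + a * c.2.
  have [zJ|nz] := boolP (z \in J); last by exists (fun=> 0, 0).
  have [y [x' [/in_span[c ->] -> ax'J]]] := Jps z zJ; exists (c, x') => _.
  by split=> //; apply/colonJ/in_ideal_colon.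
have [c cP] := choice step.
(* [X l] is the remainder after l rounds, each extracting coefficients along [ps] and dividing the
   rest by [a]. *)
move=> xJ; pose X l := iter l (fun z => (c z).2) x.
have XJ l : X l \in J by elim: l => [//|l IH]; apply: (cP _ IH).1.
have al l : a ^+ l \in filt p A l by apply/ext_filt/ideal_ext_exp/ideal_ext_in.
have zex i : exists z, forall l, z - \sum_(k < l) a ^+ k * (c (X k)).1 i \in filt p A l.
  apply: filt_lim => l; rewrite big_ord_recr /= addrAC subrr add0r.
  exact: ideal_mulr.
have [z zP] := choice zex.
have xl l : x = \sum_(i < size ps) (\sum_(k < l) a ^+ k * (c (X k)).1 i) * ps`_i
    + a ^+ l * X l.
  elim: l => [|l IH].
    by rewrite big1 ?add0r ?mul1r // => i _; rewrite big_ord0 mul0r.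
  rewrite [LHS]IH [in LHS](cP _ (XJ l)).2 mulrDr addrA mulrA -exprSr; congr (_ + _).
  rewrite mulr_sumr -big_split; apply: eq_bigr => i _ /=.
  by rewrite big_ord_recr mulrDl /= mulrA.
suff -> : x = \sum_(i < size ps) z i * ps`_i.
  by apply: rpred_sum => i _; apply/ideal_mull/span_in/mem_nth.
apply/eqP; rewrite -subr_eq0; apply/eqP/filt_sep => l.
have -> : x - \sum_(i < size ps) z i * ps`_i = a ^+ l * X l -
    \sum_(i < size ps) (z i - \sum_(k < l) a ^+ k * (c (X k)).1 i) * ps`_i.
  rewrite {1}(xl l).
  have -> : \sum_(i < size ps) (z i - \sum_(k < l) a ^+ k * (c (X k)).1 i) * ps`_i =
     \sum_(i < size ps) z i * ps`_i -
     \sum_(i < size ps) (\sum_(k < l) a ^+ k * (c (X k)).1 i) * ps`_i.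
    by rewrite -sumrB; apply: eq_bigr => i _; rewrite mulrBl.
  ring.
apply: rpredB; first exact: ideal_mulr.
by apply: rpred_sum => i _; apply: ideal_mulr.
Qed.

End MaximalNonFinGen.

(** In the manner of Cohen's theorem: an ideal J maximal among those not finitely generated contains
    p T. Modulo p T every element comes from A, so generators of the preimage of J in A together
    with generators of p generate J, a contradiction. *)
Lemma completion_noetherian : fin_gen p -> noetherian A -> noetherian T.
Proof.
move=> fp nA J0; apply: contrapT => J0nfg.
have [||J [Jnfg Jmax]] := @ideal_zorn T (fun J => ~ fin_gen J).
- by exists J0.
- move=> C Cc Cnfg [s sU]; have [|I CI sI] := @chain_union_span _ C s Cc.
    by move=> x; rewrite sU.
  apply: (Cnfg _ CI); exists s => x; apply/idP/idP => [xI|/sI//].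
  by rewrite -sU; apply/in_chain_union => //; exists I.
have pJ : {subset ideal_ext fT p <= J}.
  by apply: ideal_ext_le => r; apply: max_non_fin_gen Jnfg Jmax r.
have [s sJ] := nA (preim_ideal (@completion_in _ p A) J); have [s' s'p] := fp.
apply: Jnfg; exists (map (@completion_in _ p A) s ++ map fT s') => x; apply/idP/idP.
  move=> xJ; have [a xa] := filt_ex 1 x.
  have {}xa := filt1_ext fp xa.
  rewrite -(subrK (completion_in p a) x) addrC; apply: rpredD.
    apply: span_catl; have : a \in span s.
      rewrite -sJ; apply/in_preim_ideal.
      have : x - (x - completion_in p a) \in J by apply: rpredB => //; apply: pJ.
      by rewrite opprB addrCA subrr addr0.
    move=> as_; apply/in_preim_ideal; move: a {xa} as_; apply: span_le => a as_.
    exact/in_preim_ideal/span_in/map_f.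
  apply: span_catr; move: xa; apply: ideal_ext_le => r; rewrite s'p => rs.
  apply/in_preim_ideal; move: r rs; apply: span_le => r rs.
  exact/in_preim_ideal/span_in/map_f.
apply: span_le => z; rewrite mem_cat => /orP[] /mapP[a as_ ->].
  by apply/in_preim_ideal; rewrite sJ span_in.
by apply/pJ/ideal_ext_in; rewrite s'p span_in.
Qed.

End CompletionNoetherian.

(** * Reduction modulo a prime *)

Section SurjectiveImage.
Variables (R S : comPzRingType) (h : {rmorphism R -> S}).
Hypothesis h_surj : forall y, exists x, h x = y.

Lemma in_image_ideal (I : ideal R) y :
  y \in ideal_gen [set y | exists2 x, x \in I & y = h x] <->
  exists2 x, x \in I & y = h x.
Proof.
apply: ideal_gen_id => {y} [|_ _ [x xI ->] [y yI ->]|b _ [x xI ->]].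
- by exists 0; rewrite ?rpred0 ?rmorph0.
- by exists (x - y); rewrite ?rmorphB ?rpredB.
- by have [a <-] := h_surj b; exists (a * x); rewrite ?rmorphM ?ideal_mull.
Qed.

Lemma ideal_pow_map (I : ideal R) (I' : ideal S) l :
  (forall x, x \in I -> h x \in I') ->
  forall x, x \in ideal_pow I l -> h x \in ideal_pow I' l.
Proof.
move=> II'; elim: l => [|l IH] x; first by move=> _; apply: ideal_pow0.
rewrite !ideal_powS => xI; apply/in_preim_ideal; move: x xI.
apply: ideal_mul_le => i y iI yI; apply/in_preim_ideal; rewrite rmorphM.
by apply: ideal_mul_in; [exact: II'|exact: IH].
Qed.

Lemma ideal_pow_lift (I : ideal R) (I' : ideal S) l :
  (forall y, y \in I' -> exists2 x, x \in I & y = h x) ->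
  forall y, y \in ideal_pow I' l -> exists2 x, x \in ideal_pow I l & y = h x.
Proof.
move=> I'I; elim: l => [|l IH] y.
  by move=> _; have [x <-] := h_surj y; exists x => //; apply: ideal_pow0.
rewrite ideal_powS => yI; apply/in_image_ideal; move: y yI.
apply: ideal_mul_le => i y /I'I[j jI ->] /IH[z zl ->]; apply/in_image_ideal.
by exists (j * z); rewrite ?rmorphM // ideal_powS ideal_mul_in.
Qed.

End SurjectiveImage.

Section Reduction.
Variables (R : comPzRingType) (q : prime_ideal R).
Local Notation Rq := (ring_quot q).

(* A' is A / qA, as an algebra over R / q. *)
Definition is_reduction (A : algebra R) (A' : algebra Rq) : Prop :=
  exists phi : {rmorphism A -> A'}, [/\ forall y, exists x, phi x = y,
    forall a, phi a = 0 -> a \in ideal_ext (@alg_map R A) q &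
    forall r, phi (alg_map A r) = alg_map A' (quot_pi q r)].

Lemma base_reduction : is_reduction (base_algebra R) (base_algebra Rq).
Proof.
exists (@quot_pi R q); split=> [y|a|//]; first by exists (repr y); apply: quot_reprK.
move=> /eqP; rewrite -(rmorph0 (quot_pi q)) quot_piE subr0.
exact: (@ideal_ext_in _ _ (@alg_map R (base_algebra R))).
Qed.

Variables (p : prime_ideal R) (qp : {subset q <= p}).
Local Notation p' := (quot_prime qp).
Variables (A : algebra R) (A' : algebra Rq).
Local Notation f := (@alg_map R A).
Local Notation f' := (@alg_map Rq A').

Lemma loc_reduction :
  is_reduction A A' -> is_reduction (loc_algebra p A) (loc_algebra p' A').
Proof.
move=> [phi [phi_surj phi_ker phi_alg]].
have denP (s : {s : R | s \notin p}) : quot_pi q (\val s) \notin p'.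
  by rewrite quot_idealE (valP s).
pose den (s : {s : R | s \notin p}) : {s : Rq | s \notin p'} := Sub (quot_pi q (\val s)) (denP s).
have [Phi PhiE] : exists Phi : localization p A -> localization p' A',
    forall a s, Phi (loc_frac a s) = loc_frac (phi a) (den s).
  exists (fun x => loc_frac (phi (loc_num x)) (den (loc_den x))) => a s.
  have [u up e] := loc_reprP a s; apply/loc_fracP.
  exists (quot_pi q u); first by rewrite quot_idealE.
  by rewrite /= -!phi_alg -!rmorphM -rmorphB -rmorphM e rmorph0.
have PhiB : zmod_morphism Phi.
  elim/loc_ind=> a s; elim/loc_ind=> b t; rewrite loc_fracB !PhiE loc_fracB.
  by apply: loc_eq1; rewrite /= rmorphB !rmorphM /= !phi_alg.
have PhiM : monoid_morphism Phi.
  split; first by rewrite [LHS]PhiE rmorph1; apply: loc_eq1; rewrite /= !rmorph1.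
  elim/loc_ind=> a s; elim/loc_ind=> b t; rewrite loc_fracM !PhiE loc_fracM.
  by apply: loc_eq1; rewrite /= !rmorphM.
pose Phim : {rmorphism localization p A -> localization p' A'} :=
  HB.pack Phi (GRing.isZmodMorphism.Build _ _ Phi PhiB)
    (GRing.isMonoidMorphism.Build _ _ Phi PhiM).
exists Phim; split.
- elim/loc_ind=> b t; have [a <-] := phi_surj b.
  have tp : repr (\val t) \notin p.
    by rewrite -(quot_idealE qp) quot_reprK (valP t).
  exists (loc_frac a (Sub (repr (\val t)) tp)); rewrite [LHS]PhiE; congr loc_frac.
  by apply: val_inj; rewrite /= quot_reprK.
- elim/loc_ind=> a s; rewrite [Phim _]PhiE => /loc_fracP[u up].
  rewrite mulr0 subr0 rmorph1 mul1r -[u]quot_reprK -phi_alg -rmorphM => /phi_ker ua.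
  apply/in_loc_ext; exists (repr u) => //.
  by rewrite -(quot_idealE qp) quot_reprK.
- by move=> r; rewrite [LHS]PhiE phi_alg; apply: loc_eq1; rewrite /= !rmorph1.
Qed.

(** As phi maps p^l A onto p'^l A', it passes to limits, and a limit in A' is lifted by lifting
    successive differences. If x goes to 0, its approximations can be moved within p^l A into the
    kernel of phi, hence into q A; so x lies in q T, which is closed. *)
Lemma completion_reduction : noetherian R -> ideal_flat A -> is_reduction A A' ->
  is_reduction (completion_algebra p A) (completion_algebra p' A').
Proof.
move=> nR flatA [phi [phi_surj phi_ker phi_alg]].
have pi_surj (y : Rq) : exists x, quot_pi q x = y by exists (repr y); apply: quot_reprK.
have phi_pow l a : a \in ideal_ext f (ideal_pow p l) ->
    phi a \in ideal_ext f' (ideal_pow p' l).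
  move=> al; apply/in_preim_ideal; move: a al; apply: ideal_ext_le => r rl.
  apply/in_preim_ideal; rewrite phi_alg; apply: ideal_ext_in.
  by apply: ideal_pow_map rl => x; rewrite quot_idealE.
have pow_phi l b : b \in ideal_ext f' (ideal_pow p' l) ->
    exists2 a, a \in ideal_ext f (ideal_pow p l) & b = phi a.
  move=> bl; apply/in_image_ideal => //; move: b bl; apply: ideal_ext_le => y.
  move=> /(@ideal_pow_lift _ _ (quot_pi q) pi_surj p)[|r rl ->].
    by move=> z /asboolP[x]; exists x.
  apply/in_image_ideal => //; exists (f r); first exact: ideal_ext_in.
  by rewrite phi_alg.
(* The image of [x] is specified against all approximations of [x] at once, so the ring operations
   can be checked on arbitrary ones. *)
have ex_Phi x : exists y : completion p' A', forall l a,
    x - completion_in p a \in filt p A l ->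
    y - completion_in p' (phi a) \in filt p' A' l.
  have [a aP] := choice (fun l => @filt_ex _ p A l x).
  have [|y yP] := @filt_lim _ p' A' (fun l => completion_in p' (phi (a l))).
    move=> l; rewrite -!rmorphB; apply/filt_in/phi_pow.
    by rewrite -opprB rpredN; apply: filt_sub_ext (aP l) (aP l.+1).
  exists y => l b xb.
  have -> : y - completion_in p' (phi b) =
      (y - completion_in p' (phi (a l))) + completion_in p' (phi (a l - b)).
    by rewrite !rmorphB; ring.
  apply: rpredD => //; apply/filt_in/phi_pow.
  exact: filt_sub_ext (aP l) xb.
have [Phi PhiP] := choice ex_Phi.
have PhiE x y : (forall l, exists2 a, x - completion_in p a \in filt p A l &
    y - completion_in p' (phi a) \in filt p' A' l) -> Phi x = y.
  move=> xy; apply/eqP; rewrite -subr_eq0; apply/eqP/filt_sep => l.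
  have [a xa ya] := xy l.
  have -> : Phi x - y = (Phi x - completion_in p' (phi a)) - (y - completion_in p' (phi a)).
    by ring.
  by apply: rpredB => //; apply: PhiP.
have PhiB : zmod_morphism Phi.
  move=> x y; apply: PhiE => l; have [a xa] := filt_ex l x; have [b yb] := filt_ex l y.
  exists (a - b); rewrite !rmorphB.
    have -> : x - y - (completion_in p a - completion_in p b) =
      (x - completion_in p a) - (y - completion_in p b) by ring.
    exact: rpredB.
  have -> : Phi x - Phi y - (completion_in p' (phi a) - completion_in p' (phi b)) =
    (Phi x - completion_in p' (phi a)) - (Phi y - completion_in p' (phi b)) by ring.
  by apply: rpredB; apply: PhiP.
have PhiM : monoid_morphism Phi.
  split.
    by apply: PhiE => l; exists 1; rewrite !rmorph1 subrr rpred0.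
  move=> x y; apply: PhiE => l; have [a xa] := filt_ex l x; have [b yb] := filt_ex l y.
  exists (a * b); rewrite !rmorphM.
    have -> : x * y - completion_in p a * completion_in p b =
      y * (x - completion_in p a) + completion_in p a * (y - completion_in p b) by ring.
    by apply: rpredD; apply: ideal_mull.
  have -> : Phi x * Phi y - completion_in p' (phi a) * completion_in p' (phi b) =
    Phi y * (Phi x - completion_in p' (phi a)) +
    completion_in p' (phi a) * (Phi y - completion_in p' (phi b)) by ring.
  by apply: rpredD; apply: ideal_mull; apply: PhiP.
pose Phim : {rmorphism completion p A -> completion p' A'} :=
  HB.pack Phi (GRing.isZmodMorphism.Build _ _ Phi PhiB)
    (GRing.isMonoidMorphism.Build _ _ Phi PhiM).
exists Phim; split.
- move=> y; have [b bP] := choice (fun l => @filt_ex _ p' A' l y).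
  have ex_e l : exists e, e \in ideal_ext f (ideal_pow p l) /\ b l.+1 - b l = phi e.
    have [|e] := pow_phi l (b l.+1 - b l); last by exists e.
    by rewrite -opprB rpredN; apply: filt_sub_ext (bP l) (bP l.+1).
  have [e eP] := choice ex_e; have [a0 a0E] := phi_surj (b 0%N).
  pose a l := a0 + \sum_(j < l) e j.
  have aE l : phi (a l) = b l.
    elim: l => [|l IH]; first by rewrite /a big_ord0 addr0.
    by rewrite /a big_ord_recr addrA rmorphD [phi _]IH -(eP l).2 /= addrC subrK.
  have [|x xP] := @filt_lim _ p A (fun l => completion_in p (a l)).
    move=> l; rewrite -rmorphB; have -> : a l.+1 - a l = e l.
      by rewrite /a big_ord_recr /=; ring.
    by apply/filt_in; case: (eP l).
  by exists x; apply: PhiE => l; exists (a l); rewrite ?aE.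
- move=> x Phix; apply: completion_closed => // l.
  have [a xa] := filt_ex l x; have := PhiP _ _ _ xa.
  rewrite [Phi x]Phix sub0r rpredN => /filt_in/pow_phi[e el ae].
  exists (a - e); first by apply: phi_ker; rewrite rmorphB ae subrr.
  rewrite rmorphB opprB addrA addrAC; apply: rpredD => //.
  exact/filt_in.
- move=> r; apply: PhiE => l; exists (f r).
    by rewrite alg_map_completionE subrr rpred0.
  by rewrite alg_map_completionE phi_alg subrr rpred0.
Qed.

End Reduction.

(** * The dimension formula *)

(** [E] may be empty, the completions not being known to be nonzero: both sides are then -oo, even
    for infinite height, since +oo + -oo = -oo here. *)
Lemma nat_sup_add (H E N : set nat) : H !=set0 ->
  (forall d e, H d -> E e -> N (d + e)%N) ->
  (forall k, N k -> exists d e, [/\ H d, E e & k = (d + e)%N]) ->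
  nat_sup N = (nat_sup H + nat_sup E)%E.
Proof.
move=> [d0 Hd0] HEN NHE.
have supH d : H d -> ((d%:Z)%:E <= nat_sup H)%E by apply/(nat_supP H _).1.
have supE e : E e -> ((e%:Z)%:E <= nat_sup E)%E by apply/(nat_supP E _).1.
have supN k : N k -> ((k%:Z)%:E <= nat_sup N)%E by apply/(nat_supP N _).1.
apply/eqP; rewrite eq_le; apply/andP; split.
  apply/nat_supP => k /NHE[d [e [Hd Ee ->]]].
  by rewrite PoszD EFinD; apply: leeD; [exact: supH|exact: supE].
have [[e0 Ee0]|E0] := pselect (exists e, E e); last first.
  suff -> : nat_sup E = -oo%E by rewrite addeNy leNye.
  apply/eqP; rewrite eq_le leNye andbT; apply/nat_supP => e Ee.
  by exfalso; apply: E0; exists e.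
case Ns : (nat_sup N) supN => [z| |] supN; last 2 first.
- by rewrite leey.
- by have := supN _ (HEN _ _ Hd0 Ee0).
have leH e : E e -> (nat_sup H <= (z - e%:Z)%:E)%E.
  move=> Ee; apply/nat_supP => d Hd; have := supN _ (HEN _ _ Hd Ee).
  by rewrite !lee_fin PoszD; lia.
case Hs : (nat_sup H) supH leH => [h| |] supH leH; last 2 first.
- by have := leH _ Ee0.
- by have := supH _ Hd0.
have leE : (nat_sup E <= (z - h)%:E)%E.
  by apply/nat_supP => e /leH; rewrite !lee_fin; lia.
case: (nat_sup E) leE => [e| |] //; last by rewrite addeNy !leNye.
by rewrite -EFinD !lee_fin; lia.
Qed.

Section SurjectionChains.
Variables (R S : comPzRingType) (h : {rmorphism R -> S}).
Hypothesis h_surj : forall y, exists x, h x = y.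

Lemma prime_chain_preim n (P Q : prime_ideal S) :
  prime_chain n P Q -> prime_chain n (preim_prime h P) (preim_prime h Q).
Proof.
elim: n P => [|n IH] P /=.
  by move=> PQ x /in_preim_prime/PQ/in_preim_prime.
move=> [P' [PP' P'P] /IH c]; exists (preim_prime h P') => //; split.
  by move=> x /in_preim_prime/PP'/in_preim_prime.
move=> sub; apply: P'P => y; have [x <-] := h_surj y.
by move=> /in_preim_prime/sub/in_preim_prime.
Qed.

Lemma exists_prime_image (P : prime_ideal R) : (forall x, h x = 0 -> x \in P) ->
  exists P' : prime_ideal S, forall x, h x \in P' <-> x \in P.
Proof.
move=> kerP; pose J : ideal S := ideal_gen [set y | exists2 x, x \in P & y = h x].
have JE x : h x \in J <-> x \in P.
  split=> [/(in_image_ideal h_surj)[z zP e]|xP]; last by apply: ideal_gen_in; exists x.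
  by rewrite -(subrK z x) rpredD //; apply: kerP; rewrite rmorphB e subrr.
have J1 : 1 \notin J.
  by apply/negP; rewrite -(rmorph1 h) => /JE; apply/negP/prime_ideal1.
have JM u v : u * v \in J -> (u \in J) || (v \in J).
  have [x <-] := h_surj u; have [y <-] := h_surj v; rewrite -rmorphM.
  by move=> /JE/prime_subproofM/orP[] /JE ->; rewrite ?orbT.
by exists (prime_of J1 JM).
Qed.

Lemma prime_chain_image n (P Q : prime_ideal R) : (forall x, h x = 0 -> x \in P) ->
  prime_chain n P Q -> exists P' Q' : prime_ideal S, prime_chain n P' Q'.
Proof.
move=> kerP c; have kerQ x : h x = 0 -> x \in Q by move=> /kerP/(prime_chain_sub c).
have [P' PE] := exists_prime_image kerP; have [Q' QE] := exists_prime_image kerQ.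
exists P', Q'; elim: n P P' kerP PE c => [|n IH] P P' kerP PE /=.
  by move=> PQ y; have [x <-] := h_surj y => /PE/PQ/QE.
move=> [P1 [PP1 P1P] c]; have kerP1 x : h x = 0 -> x \in P1 by move=> /kerP/PP1.
have [P1' P1E] := exists_prime_image kerP1; exists P1'; last exact: IH c.
split=> [y|sub]; first by have [x <-] := h_surj y => /PE/PP1/P1E.
by apply: P1P => x /P1E/sub/PE.
Qed.

End SurjectionChains.

Section DimensionFormula.
Variables (R : comPzRingType) (q : prime_ideal R).
Variables (A : algebra R) (A' : algebra (ring_quot q)).
Local Notation f := (@alg_map R A).
Hypotheses (nA : noetherian A) (flatA : ideal_flat A) (redA : is_reduction A A').
Hypothesis unit_out : forall r, r \notin q -> exists y, f r * y = 1.
Hypothesis jacobson : forall z, z \in ideal_ext f q -> exists y, (1 - z) * y = 1.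

Lemma contract_eq (M : prime_ideal A) : (forall r, r \in q -> f r \in M) ->
  forall r, f r \in M <-> r \in q.
Proof.
move=> qM r; split=> [rM|]; last exact: qM.
apply: contrapT => /negP /unit_out[y ry]; move/negP: (prime_ideal1 M); apply.
by rewrite -ry ideal_mulr.
Qed.

(** P + q A is proper: if 1 = z + w with z in P and w in q A, then z = 1 - w is a unit. Any prime
    over it lies above q by [contract_eq], so none need be maximal. *)
Lemma exists_prime_above (P : prime_ideal A) :
  exists2 M : prime_ideal A, {subset P <= M} & forall r, f r \in M <-> r \in q.
Proof.
have [||x ->|M [PM _]] := @exists_prime _ (ideal_add P (ideal_ext f q)) [set 1] nA => //.
- by move=> x y -> ->; rewrite mulr1.
- apply/negP => /in_ideal_add[z zP /jacobson[y]].
  rewrite opprB addrCA subrr addr0 => zy; move/negP: (prime_ideal1 P); apply.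
  by rewrite -zy ideal_mulr.
exists M; first by move=> x xP; apply/PM/ideal_addl.
by apply: contract_eq => r rq; apply/PM/ideal_addr/ideal_ext_in.
Qed.

Lemma krull_dim_reduction :
  krull_dim A = (height q + krull_dim A')%E.
Proof.
have [phi [phi_surj phi_ker phi_alg]] := redA.
apply: nat_sup_add.
- have [|D Dq] := @prime_chain_flag _ 0 q q; first by [].
  by exists 0%N, D; rewrite Dq.
- move=> d e [D Dq] [D'].
  have c' := prime_chain_preim phi_surj (flag_prime_chain D').
  have qP : forall r, f r \in preim_prime phi (D' ord0) <-> r \in q.
    apply: contract_eq => r rq; apply/in_preim_prime.
    rewrite phi_alg (_ : quot_pi q r = 0) ?rmorph0 ?rpred0 //.
    by apply/eqP; rewrite -(rmorph0 (quot_pi q)) quot_piE subr0.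
  have Dc : prime_chain d (D ord0) q.
    by apply: prime_chainr (flag_prime_chain D) => x; rewrite Dq.
  have [Q _ cQ] := prime_chain_lift nA flatA.2 qP Dc.
  have [DA _] := prime_chain_flag (prime_chain_cat cQ c').
  by constructor.
move=> k [D]; have [M DM Mq] := exists_prime_above (D ord_max).
have c := prime_chainr DM (flag_prime_chain D).
have [i [j [Q [kij ci cj qQ]]]] := prime_chain_split nA Mq c.
exists i, j; split=> //.
  by have [Di Diq] := prime_chain_flag ci; exists Di; rewrite Diq.
have [|P' [Q' c']] := @prime_chain_image _ _ phi phi_surj j Q M _ cj.
  by move=> a /phi_ker; apply: ideal_ext_le.
by have [D' _] := prime_chain_flag c'; constructor.
Qed.

End DimensionFormula.

Section IndProCompletion.
Variables (R : comPzRingType) (n : nat) (D : flag R n).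
Hypothesis nR : noetherian R.

(** An arbitrary list of indices allows induction on the stages, and a variable [E] lets the towers
    of [D] and of [quot_flag D] grow side by side. *)
Definition indpro_tower (S : comPzRingType) (E : 'I_n.+1 -> prime_ideal S)
    (s : seq 'I_n.+1) : algebra S :=
  foldr (fun (p : prime_ideal S) (A : algebra S) =>
           completion_algebra p (loc_algebra p A))
        (base_algebra S) [seq E i | i <- s].

Lemma indpro_tower_props s : [/\ noetherian (indpro_tower D s),
  ideal_flat (indpro_tower D s) &
  is_reduction (q := D ord0) (indpro_tower D s) (indpro_tower (quot_flag D) s)].
Proof.
elim: s => [|i s [nA flatA redA]] /=.
  by split; [|exact: base_flat|exact: base_reduction].
have flatL := loc_flat (D i) flatA.
split.
- by apply: completion_noetherian; [exact: nR|exact: loc_noetherian].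
- exact: completion_flat.
- by apply: completion_reduction => //; apply: loc_reduction.
Qed.

End IndProCompletion.

Theorem proposition1p21 (R : comPzRingType) (n : nat) (D : flag R n) :
  noetherian R ->
  krull_dim (indpro_completion D) =
    (height (D ord0) + krull_dim (indpro_completion (quot_flag D)))%E.
Proof.
move=> nR; have [nA flatA redA] := indpro_tower_props D nR (enum 'I_n.+1).
apply: krull_dim_reduction => //.
(* [enum_ordSl] exposes [ord0] as the head of the list: the outermost layer localizes at p_0, which
   inverts [r], and completes along p_0, where geometric series converge. *)
- move=> r rp; rewrite /indpro_completion enum_ordSl /=.
  set B := foldr _ _ _.
  have [y ry] := loc_unit B rp; exists (completion_in (D ord0) y).
  by rewrite alg_map_completionE -rmorphM ry rmorph1.
- rewrite /indpro_completion enum_ordSl /= => z; exact: completion_unit.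
Qed.
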